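(* Let $E$ be a real Banach space, let $S=\{S(t)\}_{t\ge 0}$ be a $C_0$-semigroup on $E$ with generator $A$, let $B$ be a bounded linear operator from a real Hilbert space $H$ into $E$, let $P$ be the associated Ornstein-Uhlenbeck semigroup and $P^\circ$ its restriction to $BUC^\circ(E)$. For all $t,s\ge 0$ the following assertions are equivalent: (1) $\|P^\circ(t)-P^\circ(s)\|_{\mathcal{L}(BUC^\circ(E))}=2$; (2) $S(t)\neq S(s)$ or $\mu_t\perp\mu_s$.
   Context: Setting. $E^*$ is the dual of $E$; $Q:=BB^*\in\mathcal{L}(E^*,E)$ (with $H$ identified with its dual). For $t\ge 0$, $Q_t\in\mathcal{L}(E^*,E)$ is given by $\langle Q_tx^*,y^*\rangle=\int_0^t\langle S(s)BB^*S^*(s)x^*,y^*\rangle\,ds$ for $x^*,y^*\in E^*$. Standing assumption: for each $t\ge 0$ there is a centred Gaussian Radon measure $\mu_t$ on $E$ with covariance operator $Q_t$, i.e. a Radon probability measure under which every $x^*\in E^*$ is a centred Gaussian random variable with variance $\langle Q_tx^*,x^*\rangle$ (so $\mu_0=\delta_0$). The Ornstein-Uhlenbeck semigroup is $P(t)f(x)=\int_E f(S(t)x+y)\,d\mu_t(y)$ for bounded real-valued continuous $f$ on $E$. $BUC(E)$ is the space of bounded real-valued uniformly continuous functions on $E$ with the supremum norm; it is $P$-invariant. $BUC^\circ(E):=\{f\in BUC(E):\lim_{t\downarrow0}\|P(t)f-f\|=0\}$, a closed $P$-invariant subspace, and $P^\circ$ is the restriction of $P$ to it. $\mathcal{L}(X)$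 carries the uniform operator norm. $\mu\perp\nu$ means that there are disjoint measurable sets $C,D$ with $\mu(C)=\nu(D)=1$. *)

(* Defs.v *)
From HB Require Import structures.
From mathcomp Require Import all_boot all_order all_algebra sesquilinear.
From mathcomp Require Import all_classical all_reals all_analysis.
From mathcomp Require Import ring lra.

Set Implicit Arguments.
Unset Strict Implicit.
Unset Printing Implicit Defensive.

Import Order.TTheory GRing.Theory Num.Theory.
Import numFieldNormedType.Exports.
Local Open Scope classical_set_scope.
Local Open Scope ring_scope.

(* The family is indexed by R; its values at negative times are irrelevant. *)
Definition C0_semigroup (R : realType) (E : completeNormedModType R)
    (S : R -> {linear E -> E}) : Prop :=
  [/\ forall t, 0 <= t -> continuous (S t),
      forall x, S 0 x = x,
      forall t s x, 0 <= t -> 0 <= s -> S (t + s) x = S t (S s x) &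
      forall x, S t x @[t --> 0^'+] --> x].

(* A real Hilbert space is a complete normed space H with an inner product ip
   such that ip h h = `|h| ^+ 2 for all h. *)
Section riesz_representation.
Context (R : realType) (H : completeNormedModType R) (ip : {dot H for idfun}).

(* The representative of psi under the identification of H with its dual;
   by [riesz_ex] it exists whenever psi is linear and continuous, the value 0
   being returned otherwise. *)
Definition riesz (psi : H -> R) : H :=
  xget 0 [set h | forall k, ip h k = psi k].

Hypothesis ip_norm : forall h, ip h h = `|h| ^+ 2.

Let ipC h k : ip h k = ip k h.
Proof. by rewrite (@hermC _ _ _ _ ip) expr0 mul1r. Qed.
Let normDZ (c : R) h k :
  `|h + c *: k| ^+ 2 = `|h| ^+ 2 + 2 * c * ip h k + c ^+ 2 * `|k| ^+ 2.
Proof.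
have ipDr x y z : ip x (y + z) = ip x y + ip x z by exact: linearDr.
have ipZr x y : ip x (c *: y) = c * ip x y by exact: linearZr.
have ipDl x y z : ip (x + y) z = ip x z + ip y z.
  by rewrite ipC ipDr !(ipC z).
have ipZl x y : ip (c *: x) y = c * ip x y by rewrite ipC ipZr ipC.
by rewrite -!ip_norm ipDr !ipDl !ipZr !ipZl (ipC k h); ring.
Qed.
Let par (m E N d Ja Jb : R) : Ja < m + E / 4 -> Jb < m + E / 4 ->
  Ja = Jb + 2 * 1 * d + 1 ^+ 2 * N ->
  m <= Jb + 2 * (1 / 2) * d + (1 / 2) ^+ 2 * N -> N < E.
Proof.
have -> : (1 / 2) ^+ 2 = 1 / 4 :> R by field.
rewrite expr1n; lra.
Qed.

Lemma riesz_ex (psi : {linear H -> R^o}) : continuous psi ->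
  exists h, forall k, ip h k = psi k.
Proof.
move=> psi_cont.
pose J (h : H) : R := `|h| ^+ 2 - 2 * psi h.
pose X := range J.
have [M M_ge0 psiM] : exists2 M : R, 0 <= M & forall h, `|psi h| <= M * `|h|.
  have /linear_bounded_continuous/linear_boundedP/pinfty_ex_gt0[M M0 HM] := psi_cont.
  by exists M; [exact: ltW|exact: HM].
have Xlb : has_lbound X.
  exists (- M ^+ 2) => _ [h _ <-]; rewrite /J.
  have := psiM h; rewrite ler_norml => /andP[_ Hh].
  have := sqr_ge0 (`|h| - M); nra.
have Xinf : has_inf X by split=> //; exists (J 0), 0.
pose m := inf X.
have Jm h : m <= J h by apply: ge_inf => //; exists h.
have JDZ h (c : R) k :
    J (h + c *: k) = J h + 2 * c * (ip h k - psi k) + c ^+ 2 * `|k| ^+ 2.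
  have pZ : psi (c *: k) = c * psi k by exact: linearZ.
  by rewrite /J normDZ linearD pZ; ring.
pose A (e : R) := [set h | J h < m + e].
pose F := filter_from [set e : R | 0 < e] A.
have FF : ProperFilter F.
  apply: filter_from_proper; last first.
    move=> e e0; have [_ [h _ <-] Jh] := inf_adherent e0 Xinf.
    by exists h.
  apply: filter_from_filter; first by exists 1 => /=.
  move=> i j i0 j0; exists (Num.min i j) => /=; first by rewrite lt_min i0.
  by move=> h; rewrite /A /= -[m + _]addrC -ltrBlDr lt_min => /andP[]; lra.
have cF : cauchy F.
  apply/cauchy_ballP => e e0.
  have e4 : 0 < e ^+ 2 / 4 by rewrite divr_gt0// exprn_gt0.
  exists (A (e ^+ 2 / 4), A (e ^+ 2 / 4)) => /=.
    by split; exists (e ^+ 2 / 4).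
  move=> [a b] /= [Aa Ab]; rewrite -ball_normE /ball_ /=.
  rewrite -(ltr_pXn2r (n := 2)) ?nnegrE//; last exact: ltW.
  have := Jm (b + (1 / 2) *: (a - b)); rewrite JDZ.
  have := JDZ b 1 (a - b); rewrite scale1r subrKC.
  exact: par Aa Ab.
have /cvg_ex[h Fh] : cvg F by exact: (@cauchy_cvg H F FF cF).
exists h.
have Jc : continuous J.
  move=> x; apply: (@cvgB _ R^o).
    by apply: (@cvgM _ _ (nbhs x)); exact: (@norm_continuous _ _ x).
  by apply: (@cvgM _ _ (nbhs x)); [exact: cvg_cst|exact: psi_cont].
have Jh : J h <= m.
  apply/ler_addgt0Pr => e e0.
  have JF : J @ F --> J h by apply: continuous_cvg => //; exact: Jc.
  apply: (@closed_cvg _ _ F FF J [set r : R | r <= m + e]) JF.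
  - exact: closed_le.
  - by exists e => // x /ltW.
move=> k; apply/eqP; rewrite -subr_eq0; apply/eqP; set d := _ - _.
have q c : 0 <= 2 * c * d + c ^+ 2 * `|k| ^+ 2.
  have := Jm (h + c *: k); rewrite JDZ -/d; lra.
have N0 := sqr_ge0 `|k|.
set N := `|k| ^+ 2 in q N0.
have N1 : 0 < N + 1 by lra.
have := q (- d / (N + 1)).
have -> : 2 * (- d / (N + 1)) * d + (- d / (N + 1)) ^+ 2 * N =
  - (d ^+ 2 * (N + 2) / (N + 1) ^+ 2) by field; lra.
rewrite oppr_ge0 ler_pdivrMr ?exprn_gt0// mul0r => Hd.
apply/eqP; rewrite -sqrf_eq0 eq_le sqr_ge0 andbT; nra.
Qed.

Lemma rieszE (psi : {linear H -> R^o}) : continuous psi ->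
  forall k, ip (riesz psi) k = psi k.
Proof. by move=> /riesz_ex; exact: xgetPex. Qed.

End riesz_representation.

Section covariance_operators.
Context (R : realType) (E H : completeNormedModType R).
Variables (ip : {dot H for idfun}) (S : R -> {linear E -> E}).
Variable B : {linear H -> E}.

Definition adjoint (xs : E -> R) : H := riesz ip (xs \o B).

Definition BBadj (xs : E -> R) : E := B (adjoint xs).

(* cov_pairing t xs ys is <Q_t xs, ys>; S^*(r) xs is xs \o S r. *)
Definition cov_pairing (t : R) (xs ys : E -> R) : R :=
  \int[lebesgue_measure]_(r in `[0, t]) ys (S r (BBadj (xs \o S r))).

End covariance_operators.

Section measures.
Context (R : realType) (E : completeNormedModType R).

Definition borel := g_sigma_algebraType (@open E).

Definition radon (mu : probability borel R) : Prop :=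
  forall A : set borel, measurable A -> forall e : R, 0 < e ->
    exists K : set E, [/\ compact K, K `<=` A & (mu (A `\` K) < e%:E)%E].

(* The case v = 0 is separate because [normal_prob 0 0] is not a point mass. *)
Definition centred_gaussian (v : R) : set R -> \bar R :=
  if v == 0 then \d_(0 : R) else normal_prob 0 (Num.sqrt v).

Definition gaussian_radon (mu : probability borel R)
    (q : (E -> R) -> (E -> R) -> R) : Prop :=
  radon mu /\
  forall xs : {linear E -> R^o}, continuous xs ->
  forall A : set R, measurable A ->
    mu (xs @^-1` A) = centred_gaussian (q xs xs) A.

End measures.

Definition mutually_singular (R : realType) d (T : measurableType d)
    (mu nu : probability T R) : Prop :=
  exists C D : set T,
    [/\ measurable C, measurable D, C `&` D = set0, mu C = 1%E & nu D = 1%E].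

Section ornstein_uhlenbeck.
Context (R : realType) (E : completeNormedModType R).

Definition BUC : set (E -> R) := [set f | unif_continuous f /\ bounded_fun f].

Definition supnorm (f : E -> R) : R := sup [set `|f x| | x in [set: E]].

(* The norm of a linear operator on the subspace X of BUC. *)
Definition opnorm (X : set (E -> R)) (T : (E -> R) -> (E -> R)) : R :=
  sup [set supnorm (T f) | f in [set f | X f /\ supnorm f <= 1]].

Variables (S : R -> {linear E -> E}) (mu : R -> probability (borel E) R).

Definition OU (t : R) (f : E -> R) : E -> R :=
  fun x => \int[mu t]_y f (S t x + (y : E)).

Definition BUCo : set (E -> R) :=
  [set f | BUC f /\ supnorm (OU t f \- f) @[t --> 0^'+] --> (0 : R)].

End ornstein_uhlenbeck.

(* Main.v *)
(* The norm of P(t) - P(s) on BUCo(E) turns out to be the supremum over x of the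
   total variation distance of the laws delta_(S(t)x) * mu_t and
   delta_(S(s)x) * mu_s. If S(t) = S(s), this distance does not depend on x, and
   it equals 2 exactly when mu_t and mu_s are singular (Borel-Cantelli). If
   S(t) x0 <> S(s) x0, the two laws drift apart along x = n x0, since each of
   them is concentrated up to e on a translate of a fixed compact set.

   For the lower bound one needs test functions in BUCo(E). Trigonometric
   polynomials x |-> sum c cos(<x, xs> + b) separate disjoint compact sets, with
   values in [-1, 1] on all of E (Stone-Weierstrass and Hahn-Banach). They need
   not lie in BUCo(E), but their means f_e = 1/e int_0^e P(r) f dr do, and
   P(t) f_e(x) --> P(t) f(x) as e --> 0. On trigonometric polynomials the
   semigroup law P(h) P(r) = P(h + r) is a computation with Gaussian
   characteristic functions, so that uniqueness of Gaussian measures on E is not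
   needed. *)

Require Import Defs.
From HB Require Import structures.
From mathcomp Require Import all_boot all_order all_algebra sesquilinear.
From mathcomp Require Import all_classical all_reals all_analysis.
From mathcomp Require Import measurable_realfun.
From mathcomp Require Import ring lra.

Set Implicit Arguments.
Unset Strict Implicit.
Unset Printing Implicit Defensive.

Import Order.TTheory GRing.Theory Num.Theory.
Import numFieldNormedType.Exports.
Local Open Scope classical_set_scope.
Local Open Scope ring_scope.

(** * Separation of points by continuous functionals *)

Section hahn_banach.
Context (R : realType) (E : normedModType R).

Definition linear_graph (G : set (E * R)) :=
  forall (a : R) u r v s, G (u, r) -> G (v, s) -> G (a *: u + v, a * r + s).

Definition norm_dominated (G : set (E * R)) := forall u r, G (u, r) -> r <= `|u|.

Lemma linear_graph_extension (G : set (E * R)) (y : E) :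
    G (0, 0) -> linear_graph G -> norm_dominated G ->
  exists G' : set (E * R), [/\ G `<=` G', exists c, G' (y, c),
    linear_graph G' & norm_dominated G'].
Proof.
move=> G0 Glin Gdom.
have Gsep u r v s : G (u, r) -> G (v, s) -> r - `|u - y| <= `|v + y| - s.
  move=> ur vs.
  have : G (1 *: u + v, 1 * r + s) by exact: Glin.
  rewrite scale1r mul1r => /Gdom rs.
  have : `|u + v| <= `|u - y| + `|v + y|.
    by rewrite (_ : u + v = (u - y) + (v + y)) ?ler_normD// addrACA addNr addr0.
  lra.
pose X := [set p.2 - `|p.1 - y| | p in G].
pose c := sup X.
have Xsup : has_sup X.
  split; first by exists (0 - `|0 - y|), (0, 0).
  by exists (`|0 + y| - 0) => _ [[u r] /= ur <-]; exact: Gsep.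
have cge u r : G (u, r) -> r - `|u - y| <= c.
  by move=> ur; apply: ub_le_sup; [exact: Xsup.2|exists (u, r)].
have cle v s : G (v, s) -> c <= `|v + y| - s.
  move=> vs; apply: ge_sup; first exact: Xsup.1.
  by move=> _ [[u r] /= ur <-]; exact: Gsep.
have GZ (a : R) u r : G (u, r) -> G (a *: u, a * r).
  by move=> ur; have := Glin a _ _ _ _ ur G0; rewrite !addr0.
exists [set p | exists a u r, G (u, r) /\ p = (u + a *: y, r + a * c)]; split.
- by move=> [u r] ur; exists 0, u, r; rewrite scale0r mul0r !addr0.
- by exists c, 1, 0, 0; rewrite scale1r mul1r !add0r.
- move=> a _ _ _ _ [b [u [r [ur [-> ->]]]]] [b' [v [s [vs [-> ->]]]]].
  exists (a * b + b'), (a *: u + v), (a * r + s); split; first exact: Glin.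
  congr pair; last by ring.
  by rewrite scalerDr scalerDl scalerA addrACA.
- move=> _ _ [a [u [r [ur [-> ->]]]]].
  have [a0|a0|->] := ltgtP a 0; last first.
  + by rewrite scale0r mul0r !addr0; exact: Gdom.
  + have a0' := gt_eqF a0.
    have nE : a * `|a^-1 *: u + y| = `|u + a *: y|.
      rewrite -[in LHS](gtr0_norm a0) -normrZ gtr0_norm//.
      by rewrite scalerDr scalerA divff ?a0'// scale1r.
    have := cle _ _ (GZ a^-1 _ _ ur).
    by rewrite -(ler_pM2l a0) mulrBr mulVKf ?a0'// nE; lra.
  + have a0' := lt_eqF a0.
    have Na0 : 0 < - a by rewrite oppr_gt0.
    have nE : (- a) * `|(- a)^-1 *: u - y| = `|u + a *: y|.
      rewrite -[in LHS](gtr0_norm Na0) -normrZ gtr0_norm//.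
      rewrite scalerBr scalerA divff ?oppr_eq0 ?a0'//.
      by rewrite scale1r scaleNr opprK.
    have := cge _ _ (GZ (- a)^-1 _ _ ur).
    by rewrite -(ler_pM2l Na0) mulrBr mulVKf ?oppr_eq0 ?a0'// nE; lra.
Qed.

Lemma continuous_functional_neq0 (x : E) : x != 0 ->
  exists f : {linear E -> R^o}, continuous f /\ f x != 0.
Proof.
move=> x0.
pose G0 := [set p : E * R | exists a, p = (a *: x, a * `|x|)].
have G0lin : linear_graph G0.
  move=> a _ _ _ _ [b [-> ->]] [b' [-> ->]]; exists (a * b + b').
  by congr pair; [rewrite scalerDl scalerA|ring].
have G0dom : norm_dominated G0.
  move=> _ _ [a [-> ->]]; rewrite normrZ ler_wpM2r// ler_norm //.
have G00 : G0 (0, 0) by exists 0; rewrite scale0r mul0r.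
pose P := [set G | linear_graph (G `|` G0) /\ norm_dominated (G `|` G0)].
have [F FP Fchain|A [[Alin Adom] Amax]] := @Zorn_bigcup _ P.
  split; last first.
    move=> u r [[X FX Xur]|]; last exact: G0dom.
    by apply: (FP _ FX).2; left.
  move=> a u r v s [[X FX Xu]|Gu] [[Y FY Yv]|Gv].
  - have [XY|YX] := Fchain _ _ FX FY.
      have [Z|Z] := (FP _ FY).1 a u r v s (or_introl (XY _ Xu)) (or_introl Yv).
        by left; exists Y.
      by right.
    have [Z|Z] := (FP _ FX).1 a u r v s (or_introl Xu) (or_introl (YX _ Yv)).
      by left; exists X.
    by right.
  - have [Z|Z] := (FP _ FX).1 a u r v s (or_introl Xu) (or_intror Gv).
      by left; exists X.
    by right.
  - have [Z|Z] := (FP _ FY).1 a u r v s (or_intror Gu) (or_introl Yv).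
      by left; exists Y.
    by right.
  - by right; exact: G0lin.
pose G := A `|` G0.
have Gtotal y : exists c, G (y, c).
  have [G' [GG' [c G'yc] G'lin G'dom]] :=
    @linear_graph_extension G y (or_intror G00) Alin Adom.
  apply: contrapT => nG.
  have G'G0 : G' `|` G0 = G' by apply: setUidl => p Gp; apply: GG'; right.
  apply: (Amax G'); last by rewrite /P /= G'G0.
  split; first by move=> p Ap; apply: GG'; left.
  by move=> G'A; apply: nG; exists c; left; exact: G'A.
have Gfun y c c' : G (y, c) -> G (y, c') -> c = c'.
  have Gle b b' : G (y, b) -> G (y, b') -> b' <= b.
    move=> yb yb'; have := Adom _ _ (Alin (-1) _ _ _ _ yb yb').
    by rewrite scaleN1r addNr normr0; lra.
  by move=> yc yc'; apply/eqP; rewrite eq_le !Gle.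
pose f y := xget 0 [set c | G (y, c)].
have fG y : G (y, f y).
  by have [c yc] := Gtotal y; exact: (@xgetPex _ 0 [set c | G (y, c)] (ex_intro _ c yc)).
have flin : linear (f : E -> R^o).
  by move=> a u v; apply: (Gfun _ _ _ (fG _)); exact: (Alin a _ _ _ _ (fG u) (fG v)).
pose F : {linear E -> R^o} := HB.pack (f : E -> R^o) (GRing.isLinear.Build _ _ _ _ _ flin).
exists F; split.
  apply/linear_bounded_continuous/linear_boundedP; exists 1.
  split; first exact: num_real.
  move=> M M1 y /=.
  have fle z : f z <= `|z| by apply: Adom; exact: fG.
  have fN : f (- y) = - f y by exact: (linearN F).
  change (`|f y| <= M * `|y|).
  apply: (@le_trans _ _ `|y|); last by rewrite ler_peMl// ltW.
  by rewrite ler_norml fle andbT lerNl -fN (le_trans (fle _))// normrN.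
rewrite /= (Gfun x (f x) `|x|) ?normr_eq0//.
by right; exists 1; rewrite scale1r mul1r.
Qed.

End hahn_banach.

(** * Integrals of bounded functions and translations of the Lebesgue measure *)

Section bounded_integrals.
Context d (T : measurableType d) (R : realType).
Variable mu : {measure set T -> \bar R}.

Lemma integrable_bounded D (f : T -> R) (M : R) : measurable D ->
  (mu D < +oo)%E -> measurable_fun D f -> (forall x, D x -> `|f x| <= M) ->
  mu.-integrable D (EFin \o f).
Proof.
move=> mD Dfin mf fM; apply: measurable_bounded_integrable => //.
exists M; split; first exact: num_real.
by move=> x Mx y Dy; exact: le_trans (fM _ Dy) (ltW Mx).
Qed.

Lemma EFin_Rintegral D (f : T -> R) : measurable D ->
  mu.-integrable D (EFin \o f) ->
  (\int[mu]_(x in D) (f x)%:E)%E = (\int[mu]_(x in D) f x)%:E.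
Proof. by move=> mD fi; rewrite fineK//; exact: integrable_fin_num. Qed.

Lemma le_normr_Rintegral_bounded D (f : T -> R) (M : R) : measurable D ->
  (mu D < +oo)%E -> measurable_fun D f -> (forall x, D x -> `|f x| <= M) ->
  `|\int[mu]_(x in D) f x| <= M * fine (mu D).
Proof.
move=> mD Dfin mf fM.
apply: le_trans (le_normr_Rintegral mD (integrable_bounded mD Dfin mf fM)) _.
rewrite -Rintegral_cst//; apply: le_Rintegral => //.
- apply: (@integrable_bounded _ _ M) => //; first exact: measurableT_comp.
  by move=> x Dx; rewrite normr_id fM.
- by apply: (@integrable_bounded _ _ `|M|).
Qed.

End bounded_integrals.

Section lebesgue_shift.
Context {R : realType}.
Notation leb := (@lebesgue_measure R).
Implicit Types (f : R -> R) (h : R).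

Lemma lebesgue_measure_itvcc_lty (a b : R) : (leb `[a, b] < +oo)%E.
Proof. by rewrite lebesgue_measure_itv/=; case: ifP => // _; rewrite -EFinB ltry. Qed.

Lemma measurable_shift h : measurable_fun [set: measurableTypeR R]
  (fun x : measurableTypeR R => x + h : measurableTypeR R).
Proof. exact: (@measurable_funD _ (measurableTypeR R)). Qed.

Lemma lebesgue_measure_shift h (A : set R) : measurable A ->
  pushforward leb (fun x => x + h : measurableTypeR R) A = leb A.
Proof.
move=> mA; apply/esym.
apply: (lebesgue_measure_unique
  (mu := pushforward leb (fun x => x + h : measurableTypeR R))) => //.
  exact: measurable_shift.
move=> mh _ [[a b]] _ <-; rewrite -[RHS]/(leb ((fun x => x + h) @^-1` `]a, b])).
have -> : (fun x => x + h) @^-1` `]a, b] = `](a - h), (b - h)]%classic.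
  by apply/seteqP; split=> x /=; rewrite !in_itv/= ltrBlDr lerBrDr.
rewrite !lebesgue_measure_itv/= !lte_fin ltrD2r -!EFinB opprB addrA.
by rewrite subrK.
Qed.

Lemma integral_shift h (D : set R) (f : R -> \bar R) : measurable D ->
    measurable_fun setT f ->
    leb.-integrable ((fun x => x + h) @^-1` D) (fun x => f (x + h)) ->
  (\int[leb]_(x in D) f x = \int[leb]_(x in (fun x => x + h)%R @^-1` D) f (x + h)%R)%E.
Proof.
move=> mD mf intf.
have := integral_pushforward (measurable_shift h) mf intf mD => /= <-.
apply: eq_measure_integral; first exact: measurable_shift.
by move=> mh A mA AD; exact/esym/lebesgue_measure_shift.
Qed.

Lemma Rintegral_itv_shift (f : R -> R) (h a b M : R) : measurable_fun setT f ->
    (forall x, a <= x <= b -> `|f (x + h)| <= M) ->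
  \int[leb]_(x in `[a, b]) f (x + h) = \int[leb]_(x in `[a + h, b + h]) f x.
Proof.
move=> mf fM; rewrite /Rintegral.
have abE : (fun x => x + h) @^-1` `[a + h, b + h] = `[a, b]%classic.
  by apply/seteqP; split=> x /=; rewrite !in_itv/= !lerD2r.
rewrite [in RHS](@integral_shift h)//; first by rewrite abE.
- exact/measurable_EFinP.
- rewrite abE.
  apply: (@integrable_bounded _ (measurableTypeR R) _ leb _ (fun x => f (x + h)) M) => //.
  + exact: lebesgue_measure_itvcc_lty.
  + by apply: measurable_funTS; apply: (measurableT_comp mf); exact: measurable_shift.
Qed.

End lebesgue_shift.

(** * Characteristic functions of centred Gaussian laws *)

Section gaussian_characteristic_function.
Context {R : realType}.
Notation leb := (@lebesgue_measure R).
Implicit Types v w y z : R.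

Definition gauss_pdf v : R -> R := normal_pdf 0 (Num.sqrt v).

Lemma gauss_pdfE v y : 0 < v ->
  gauss_pdf v y = (Num.sqrt (v * pi *+ 2))^-1 * expR (- y ^+ 2 / (v *+ 2)).
Proof.
move=> v0; have v0' := ltW v0.
rewrite /gauss_pdf normal_pdfE ?gt_eqF ?sqrtr_gt0// /normal_peak /normal_fun.
by rewrite sqr_sqrtr// subr0.
Qed.

Lemma measurable_gauss_pdf v : measurable_fun setT (gauss_pdf v).
Proof. exact: measurable_normal_pdf. Qed.

Lemma gauss_pdf_ge0 v y : 0 <= gauss_pdf v y.
Proof. exact: normal_pdf_ge0. Qed.

Lemma integral_gauss_pdf v : (\int[leb]_y (gauss_pdf v y)%:E = 1)%E.
Proof. exact: integral_normal_pdf. Qed.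

Lemma integrable_gauss_pdf v : leb.-integrable setT (EFin \o gauss_pdf v).
Proof. exact: integrable_normal_pdf. Qed.

Lemma integrable_mul_gauss_pdf (f : R -> R) M v : measurable_fun setT f ->
  (forall y, `|f y| <= M) -> leb.-integrable setT (EFin \o (fun y => f y * gauss_pdf v y)).
Proof.
move=> mf fM.
apply: (@le_integrable _ (measurableTypeR R) _ leb _ _ _
  (EFin \o (fun y => M * gauss_pdf v y))) => //.
- apply/measurable_EFinP; apply: measurable_funM => //; exact: measurable_gauss_pdf.
- move=> y _; rewrite lee_fin !normrM ler_wpM2r// (le_trans (fM y))// ler_norm//.
- rewrite (_ : EFin \o _ = fun y => (M%:E * (gauss_pdf v y)%:E)%E)//.
  by apply: integrableZl => //; exact: integrable_gauss_pdf.
Qed.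

(* Completing the square. *)
Lemma gauss_pdf_convolution v w y z : 0 < v -> 0 < w ->
  gauss_pdf v (z - y) * gauss_pdf w y = gauss_pdf (v + w) z *
    normal_pdf (w * z / (v + w)) (Num.sqrt (v * w / (v + w))) y.
Proof.
move=> v0 w0; have vw0 : 0 < v + w by rewrite addr_gt0.
have u0 : 0 < v * w / (v + w) by rewrite divr_gt0// mulr_gt0.
have p0 := pi_gt0 R.
rewrite !gauss_pdfE// normal_pdfE ?gt_eqF ?sqrtr_gt0// /normal_peak /normal_fun.
rewrite sqr_sqrtr ?ltW// mulrACA [RHS]mulrACA -!expRD -!invfM -!sqrtrM; last 2 first.
- by rewrite mulrn_wge0// mulr_ge0 ?ltW.
- by rewrite mulrn_wge0// mulr_ge0 ?ltW.
congr ((Num.sqrt _)^-1 * expR _); field.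
  by rewrite gt_eqF.
by rewrite !gt_eqF.
Qed.

Lemma Rintegral_oppr (f : R -> R) : measurable_fun setT f ->
    leb.-integrable setT (EFin \o f) ->
  \int[leb]_y f (- y) = \int[leb]_y f y.
Proof.
move=> mf intf; rewrite /Rintegral; congr fine.
have mN : measurable_fun [set: measurableTypeR R]
    (-%R : measurableTypeR R -> measurableTypeR R).
  exact: oppr_measurable.
have mEf : measurable_fun [set: measurableTypeR R] (EFin \o f) by exact/measurable_EFinP.
have intN : leb.-integrable (-%R @^-1` setT) ((EFin \o f) \o -%R).
  rewrite preimage_setT; apply/integrableP; split.
    exact: measurableT_comp.
  have /integrableP[_] := intf; congr (_ < _)%E.
  transitivity (\int[pushforward leb
      (-%R : measurableTypeR R -> measurableTypeR R)]_y `|(f y)%:E|)%E.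
    apply: eq_measure_integral => A mA AT; exact/esym/lebesgue_measureN.
  rewrite ge0_integral_pushforward//; exact: measurableT_comp.
have := integral_pushforward mN mEf intN measurableT.
rewrite preimage_setT => <-.
by apply: eq_measure_integral => A mA AT; exact: lebesgue_measureN.
Qed.

Lemma Rintegral_shiftT (f : R -> R) (h : R) : measurable_fun setT f ->
    leb.-integrable setT (EFin \o (fun y => f (y + h))) ->
  \int[leb]_y f y = \int[leb]_y f (y + h).
Proof.
move=> mf intf; rewrite /Rintegral; congr fine.
by apply: (@integral_shift _ h setT (EFin \o f)) => //; exact/measurable_EFinP.
Qed.

(* The case v = 0 is separate because [normal_pdf 0 0] is the uniform density. *)
Definition gauss_cf v : R :=
  if v == 0 then 1 else \int[leb]_y (cos y * gauss_pdf v y).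

Lemma gauss_cf0 : gauss_cf 0 = 1. Proof. by rewrite /gauss_cf eqxx. Qed.

Lemma measurable_cos : measurable_fun setT (@cos R).
Proof. by apply: continuous_measurable_fun; exact: continuous_cos. Qed.

Lemma measurable_sin : measurable_fun setT (@sin R).
Proof. by apply: continuous_measurable_fun; exact: continuous_sin. Qed.

Lemma integrable_cos_gauss v : leb.-integrable setT (EFin \o (fun y => cos y * gauss_pdf v y)).
Proof.
apply: integrable_mul_gauss_pdf; first exact: measurable_cos.
exact: cos_max.
Qed.

Lemma integrable_sin_gauss v : leb.-integrable setT (EFin \o (fun y => sin y * gauss_pdf v y)).
Proof.
apply: integrable_mul_gauss_pdf; first exact: measurable_sin.
exact: sin_max.
Qed.

Lemma integral_sin_gauss v : 0 < v -> \int[leb]_y (sin y * gauss_pdf v y) = 0.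
Proof.
move=> v0; have := Rintegral_oppr _ (integrable_sin_gauss v).
have -> : \int[leb]_y (sin (- y) * gauss_pdf v (- y)) =
    - \int[leb]_y (sin y * gauss_pdf v y).
  rewrite -mulN1r -RintegralZl//; last exact: integrable_sin_gauss.
  apply: eq_Rintegral => y _; rewrite sinN mulN1r mulNr.
  by rewrite !gauss_pdfE// sqrrN.
move=> H; have : measurable_fun setT (fun y : R => sin y * gauss_pdf v y).
  by apply: measurable_funM; [exact: measurable_sin|exact: measurable_gauss_pdf].
by move=> /H; lra.
Qed.

Lemma integral_cosD_gauss v b : 0 < v ->
  \int[leb]_y (cos (y + b) * gauss_pdf v y) = gauss_cf v * cos b.
Proof.
move=> v0; rewrite /gauss_cf gt_eqF//.
under eq_Rintegral do rewrite cosD mulrBl -!mulrA (mulrC (cos b)) (mulrC (sin b)) !mulrA.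
rewrite RintegralB//; last 2 first.
- rewrite (_ : EFin \o _ = fun y => ((cos y * gauss_pdf v y)%:E * (cos b)%:E)%E)//.
  by apply: integrableZr => //; exact: integrable_cos_gauss.
- rewrite (_ : EFin \o _ = fun y => ((sin y * gauss_pdf v y)%:E * (sin b)%:E)%E)//.
  by apply: integrableZr => //; exact: integrable_sin_gauss.
rewrite !RintegralZr//; [|exact: integrable_sin_gauss|exact: integrable_cos_gauss].
by rewrite integral_sin_gauss// mul0r subr0.
Qed.

Let gauss_kernel v w (p : measurableTypeR R * measurableTypeR R) : \bar R :=
  (cos p.1 * (gauss_pdf v (p.1 - p.2) * gauss_pdf w p.2))%:E.

Let measurable_gauss_kernel v w : measurable_fun setT (gauss_kernel v w).
Proof.
apply/measurable_EFinP; apply: measurable_funM.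
  by apply: measurableT_comp; [exact: measurable_cos|exact: measurable_fst].
apply: measurable_funM.
  apply: measurableT_comp; first exact: measurable_gauss_pdf.
  by apply: measurable_funB; [exact: measurable_fst|exact: measurable_snd].
by apply: measurableT_comp; [exact: measurable_gauss_pdf|exact: measurable_snd].
Qed.

Let integral_gauss_kernel v w z : 0 < v -> 0 < w ->
  (\int[leb]_y gauss_kernel v w (z, y) = (cos z * gauss_pdf (v + w) z)%:E)%E.
Proof.
move=> v0 w0; under eq_integral do rewrite /gauss_kernel/= gauss_pdf_convolution// mulrA EFinM.
by rewrite integralZl//= ?integral_normal_pdf ?mule1//; exact: integrable_normal_pdf.
Qed.

Let integrable_gauss_kernel v w : 0 < v -> 0 < w ->
  (leb \x leb)%E.-integrable setT (gauss_kernel v w).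
Proof.
move=> v0 w0; apply/integrable12ltyP; first exact: measurable_gauss_kernel.
apply: (@le_lt_trans _ _ (\int[leb]_z (gauss_pdf (v + w) z)%:E)%E); last first.
  by rewrite integral_gauss_pdf ltry.
apply: ge0_le_integral => //.
- by move=> z _; apply: integral_ge0.
- apply: (@measurable_fun_fubini_tonelli_F _ _ (measurableTypeR R)
    (measurableTypeR R) R leb (fun p => `|gauss_kernel v w p|)%E) => //.
  by apply: measurableT_comp => //; exact: measurable_gauss_kernel.
- by apply/measurable_EFinP; exact: measurable_gauss_pdf.
- move=> z _.
  have -> : (\int[leb]_y `|gauss_kernel v w (z, y)| =
     \int[leb]_y ((`|cos z| * gauss_pdf (v + w) z)%:E *
       (normal_pdf (w * z / (v + w)) (Num.sqrt (v * w / (v + w))) y)%:E))%E.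
    apply: eq_integral => y _; rewrite /gauss_kernel/= gauss_pdf_convolution// -EFinM.
    congr EFin; rewrite normrM -[RHS]mulrA; congr (_ * _); apply: ger0_norm.
    by apply: mulr_ge0; [exact: gauss_pdf_ge0|exact: normal_pdf_ge0].
  rewrite integralZl//; last exact: integrable_normal_pdf.
  rewrite integral_normal_pdf mule1 lee_fin ler_piMl ?gauss_pdf_ge0//.
  exact: cos_max.
Qed.

Lemma gauss_cfD v w : 0 <= v -> 0 <= w ->
  gauss_cf (v + w) = gauss_cf v * gauss_cf w.
Proof.
rewrite !le0r => /predU1P[->|v0]; first by rewrite add0r gauss_cf0 mul1r.
case/predU1P => [->|w0]; first by rewrite addr0 gauss_cf0 mulr1.
have vw0 : 0 < v + w by rewrite addr_gt0.
have := Fubini (integrable_gauss_kernel v0 w0).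
under eq_integral do rewrite integral_gauss_kernel//.
move=> /(congr1 fine) H.
transitivity (\int[leb]_z (cos z * gauss_pdf (v + w) z)).
  by rewrite /gauss_cf gt_eqF.
rewrite /Rintegral H.
have inner y : (\int[leb]_z gauss_kernel v w (z, y) =
    (gauss_cf v * (cos y * gauss_pdf w y))%:E)%E.
  have ib : leb.-integrable setT (EFin \o (fun z => cos (z + y) * gauss_pdf v z)).
    apply: integrable_mul_gauss_pdf => [|z]; last exact: cos_max.
    by apply: measurableT_comp => //; [exact: measurable_cos|exact: measurable_funD].
  have mb : measurable_fun setT (fun z => cos z * gauss_pdf v (z - y)).
    apply: measurable_funM; first exact: measurable_cos.
    apply: measurableT_comp; first exact: measurable_gauss_pdf.
    exact: measurable_funB.
  have bE : (fun z => cos (z + y) * gauss_pdf v (z + y - y)) =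
      (fun z => cos (z + y) * gauss_pdf v z).
    by apply/funext => z; rewrite addrK.
  have ib' : leb.-integrable setT (EFin \o (fun z => cos z * gauss_pdf v (z - y))).
    apply: (@le_integrable _ (measurableTypeR R) _ leb _ _ _
      (EFin \o (normal_pdf y (Num.sqrt v)))) => //.
    - exact/measurable_EFinP.
    - move=> z _; rewrite lee_fin normrM !(ger0_norm (normal_pdf_ge0 _ _ _)).
      rewrite (_ : normal_pdf y _ z = gauss_pdf v (z - y)).
        by rewrite ler_piMl ?gauss_pdf_ge0// cos_max.
      by rewrite /gauss_pdf /normal_pdf /normal_fun subr0 gt_eqF// sqrtr_gt0.
    - exact: integrable_normal_pdf.
  have -> : (\int[leb]_z gauss_kernel v w (z, y) =
      \int[leb]_z ((gauss_pdf w y)%:E * (cos z * gauss_pdf v (z - y))%:E))%E.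
    by apply: eq_integral => z _; rewrite /gauss_kernel/= -EFinM; congr EFin; ring.
  rewrite integralZl// (EFin_Rintegral _ ib')// (@Rintegral_shiftT _ y)//; rewrite bE//.
  by rewrite integral_cosD_gauss// -EFinM; congr EFin; ring.
under eq_integral do rewrite inner EFinM.
rewrite integralZl//; last exact: integrable_cos_gauss.
by rewrite (EFin_Rintegral _ (integrable_cos_gauss w))//= {3}/gauss_cf gt_eqF.
Qed.

End gaussian_characteristic_function.

Section trigonometric_bounds.
Context {R : realType}.
Implicit Types a b y : R.

Lemma dist_cos_le a b : `|cos a - cos b| <= `|a - b|.
Proof.
wlog ba : a b / b <= a => [H|].
  have [|/ltW] := leP b a; first exact: H.
  by move=> /H; rewrite distrC (distrC b).
have [c _ ->] : exists2 c, c \in `[b, a] & cos a - cos b = - sin c * (a - b).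
  apply: (@MVT_segment _ cos (fun c => - sin c)) => //.
  by apply: continuous_subspaceT; exact: continuous_cos.
by rewrite normrM normrN ler_piMl// sin_max.
Qed.

Lemma dist_sin_le a b : `|sin a - sin b| <= `|a - b|.
Proof.
have E c : sin c = cos (c - pi / 2) by rewrite cosBpihalf.
by rewrite !E (le_trans (dist_cos_le _ _))// opprB addrA subrK.
Qed.

Lemma one_sub_cos_le y : 1 - cos y <= y ^+ 2 / 2.
Proof.
set z := y / 2; have -> : y = z *+ 2 by rewrite /z -[RHS]mulr_natr divfK.
have : `|sin z| <= `|z| by have := dist_sin_le z 0; rewrite sin0 !subr0.
rewrite -ler_sqr ?nnegrE// !real_normK ?num_real// cos_mulr2n cos2sin2 mulr2n.
by rewrite mulr2n; nra.
Qed.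

End trigonometric_bounds.

Section gaussian_characteristic_function_bounds.
Context {R : realType}.
Notation leb := (@lebesgue_measure R).
Implicit Types v w y z : R.

Lemma gauss_cf_le1 v : `|gauss_cf v| <= 1.
Proof.
rewrite /gauss_cf; case: ifP => _; first by rewrite normr1.
apply: (le_trans (le_normr_Rintegral _ (integrable_cos_gauss _))) => //.
rewrite -lee_fin -(integral_gauss_pdf v) (EFin_Rintegral _ (integrable_gauss_pdf v))// lee_fin.
apply: le_Rintegral => //.
- rewrite (_ : EFin \o _ = (abse \o (fun y => (cos y * gauss_pdf v y)%:E)))//.
  by apply: integrable_abse; exact: integrable_cos_gauss.
- exact: integrable_gauss_pdf.
- move=> y _; rewrite normrM (ger0_norm (gauss_pdf_ge0 _ _)).
  by rewrite ler_piMl ?gauss_pdf_ge0// cos_max.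
Qed.

(* Since u <= e^u, the density of variance v times y^2 is at most 8 v times the
   density of variance 2 v, which spares us the second moment. *)
Lemma gauss_pdf_mul_sqr_le v y : 0 < v ->
  y ^+ 2 * gauss_pdf v y <= 8 * v * gauss_pdf (v *+ 2) y.
Proof.
move=> v0; have v20 : 0 < v *+ 2 by rewrite pmulrn_lgt0.
have p0 := pi_gt0 R.
have s1 : 0 < Num.sqrt (v * pi *+ 2) by rewrite sqrtr_gt0 pmulrn_lgt0// mulr_gt0.
have s2 : 0 < Num.sqrt (v *+ 2 * pi *+ 2).
  by rewrite sqrtr_gt0 pmulrn_lgt0// mulr_gt0.
have s12 : (Num.sqrt (v * pi *+ 2))^-1 <= 2 * (Num.sqrt (v *+ 2 * pi *+ 2))^-1.
  have E : Num.sqrt (v *+ 2 * pi *+ 2) <= 2 * Num.sqrt (v * pi *+ 2).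
    rewrite -[2](@ger0_norm R)// -sqrtr_sqr -sqrtrM ?sqr_ge0// ler_wsqrtr//.
    have := mulr_gt0 v0 p0; lra.
  by rewrite ler_pdivlMr// mulrC ler_pdivrMr.
have yE : y ^+ 2 * expR (- y ^+ 2 / (v *+ 2)) <= 4 * v * expR (- y ^+ 2 / (v *+ 2 *+ 2)).
  set u := y ^+ 2 / (4 * v).
  have u0 : 0 <= u by rewrite divr_ge0 ?sqr_ge0 ?mulr_ge0 ?ltW.
  have -> : - y ^+ 2 / (v *+ 2) = - u - u.
    by rewrite /u; field; rewrite gt_eqF.
  have -> : - y ^+ 2 / (v *+ 2 *+ 2) = - u.
    by rewrite /u; field; rewrite gt_eqF.
  have -> : y ^+ 2 = 4 * v * u by rewrite /u; field; rewrite gt_eqF.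
  have ue1 : u * expR (- u) <= 1.
    rewrite -(expRxMexpNx_1 u) ler_wpM2r ?expR_ge0//.
    by have := expR_ge1Dxn 0 u0; rewrite expr1 divr1; lra.
  rewrite expRD (_ : _ * _ * _ = 4 * v * expR (- u) * (u * expR (- u))); last by ring.
  by rewrite -[leRHS]mulr1 ler_wpM2l// !mulr_ge0 ?expR_ge0 ?ltW.
rewrite !gauss_pdfE// mulrCA.
apply: le_trans (ler_wpM2l _ yE) _; first by rewrite invr_ge0 ltW.
set e := expR (- y ^+ 2 / (v *+ 2 *+ 2)).
have e0 : 0 <= 4 * v * e by rewrite !mulr_ge0 ?expR_ge0 ?ltW.
have := ler_wpM2r e0 s12.
lra.
Qed.

Lemma gauss_cf_near1 v : 0 <= v -> `|1 - gauss_cf v| <= 4 * v.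
Proof.
rewrite le0r => /predU1P[->|v0]; first by rewrite gauss_cf0 subrr normr0 mulr0.
have cf1 := gauss_cf_le1 v; rewrite ger0_norm; last first.
  by rewrite subr_ge0 (le_trans _ cf1)// ler_norm.
have pE u : \int[leb]_y gauss_pdf u y = 1.
  apply: EFin_inj; rewrite -EFin_Rintegral ?integral_gauss_pdf//.
  exact: integrable_gauss_pdf.
rewrite -[X in X - _](pE v) /gauss_cf gt_eqF// -RintegralB//; last 2 first.
- exact: integrable_gauss_pdf.
- exact: integrable_cos_gauss.
have -> : 4 * v = \int[leb]_y (4 * v * gauss_pdf (v *+ 2) y).
  by rewrite RintegralZl ?pE ?mulr1//; exact: integrable_gauss_pdf.
apply: le_Rintegral => //.
- rewrite (_ : EFin \o _ = ((EFin \o gauss_pdf v) \-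
    (EFin \o (fun y => cos y * gauss_pdf v y)%R))%E)//.
  by apply: integrableB => //; [exact: integrable_gauss_pdf|exact: integrable_cos_gauss].
- rewrite (_ : EFin \o _ = fun y => ((4 * v)%:E * (gauss_pdf (v *+ 2) y)%:E)%E)//.
  by apply: integrableZl => //; exact: integrable_gauss_pdf.
- move=> y _; have := gauss_pdf_mul_sqr_le y v0; have := one_sub_cos_le y.
  have := gauss_pdf_ge0 v y; nra.
Qed.

End gaussian_characteristic_function_bounds.

Section gaussian_law.
Context {R : realType}.
Notation leb := (@lebesgue_measure R).

Lemma Rintegral_normal_prob (m s : R) (f : R -> R) M : measurable_fun setT f ->
    (forall x, `|f x| <= M) ->
  \int[normal_prob m s]_x f x = \int[leb]_x (f x * normal_pdf m s x).
Proof.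
move=> mf fM; rewrite /Rintegral; congr fine.
have dom := normal_prob_dominates m s.
have intf : (normal_prob m s).-integrable setT (EFin \o f).
  by apply: (@integrable_bounded _ _ _ _ _ _ M) => //; exact: fin_num_fun_lty.
have mp := measurable_normal_pdf m s.
rewrite -(Radon_Nikodym_change_of_variables dom measurableT intf).
under [RHS]eq_integral do rewrite EFinM.
apply: ae_eq_integral => //.
- apply: emeasurable_funM; first exact/measurable_EFinP.
  by apply: measurable_int; exact: Radon_Nikodym_integrable.
- by apply: emeasurable_funM; exact/measurable_EFinP.
apply: ae_eqe_mul2l.
apply: integral_ae_eq => //.
- exact: Radon_Nikodym_integrable.
- exact/measurable_EFinP.
- by move=> A _ mA; rewrite -Radon_Nikodym_integral.
Qed.

Lemma Rintegral_cos_gaussian d (T : measurableType d) (mu : probability T R)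
    (X : T -> R) (v b : R) : 0 <= v -> measurable_fun setT X ->
    (forall A, measurable A -> mu (X @^-1` A) = centred_gaussian v A) ->
  \int[mu]_y cos (X y + b) = gauss_cf v * cos b.
Proof.
move=> v0 mX muX.
have mf : measurable_fun setT (fun x : R => cos (x + b)).
  by apply: measurableT_comp; [exact: measurable_cos|exact: measurable_funD].
have intX : mu.-integrable (X @^-1` setT) ((EFin \o (fun x : R => cos (x + b))) \o X).
  rewrite preimage_setT.
  apply: (@integrable_bounded _ _ _ _ _ (fun y => cos (X y + b)) 1) => //.
  - exact: fin_num_fun_lty.
  - exact: (measurableT_comp mf).
  - by move=> x _; exact: cos_max.
have mEf : measurable_fun setT (EFin \o (fun x : R => cos (x + b))).
  exact/measurable_EFinP.
have mX' : measurable_fun setT (X : T -> measurableTypeR R) by exact: mX.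
have mEf' : measurable_fun [set: measurableTypeR R] (EFin \o (fun x : R => cos (x + b))).
  exact: mEf.
have pE := integral_pushforward mX' mEf' intX measurableT.
rewrite /Rintegral -[(\int[mu]_y (cos (X y + b))%:E)%E]pE.
have [v00|vN0] := eqVneq v 0.
  rewrite v00 gauss_cf0 mul1r (eq_measure_integral (\d_(0 : measurableTypeR R))); last first.
    by move=> A mA _; rewrite -[LHS]/(mu (X @^-1` A)) muX// /centred_gaussian v00 eqxx.
  by rewrite integral_dirac// diracT mul1e /= add0r.
rewrite (eq_measure_integral (normal_prob 0 (Num.sqrt v))); last first.
  move=> A mA _; rewrite -[LHS]/(mu (X @^-1` A)) muX// /centred_gaussian.
  by rewrite (negbTE vN0).
rewrite -integral_cosD_gauss ?lt0r ?vN0//.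
by apply: (@Rintegral_normal_prob _ _ _ 1) => // x; exact: cos_max.
Qed.

End gaussian_law.

Lemma continuous_linear_bounded (R : realType) (V W : normedModType R) (f : {linear V -> W}) :
  continuous f -> exists2 M : R, 0 < M & forall x, `|f x| <= M * `|x|.
Proof.
by move=> /linear_bounded_continuous/linear_boundedP/pinfty_ex_gt0[M M0 fM]; exists M.
Qed.

Section c0_semigroups.
Context (R : realType) (E : completeNormedModType R) (S : R -> {linear E -> E}).
Hypothesis S_C0 : C0_semigroup S.
Implicit Types (r s d e M T : R) (x : E).

Let S_continuous r : 0 <= r -> continuous (S r). Proof. by case: S_C0 => + _ _ _; exact. Qed.
Let S0 x : S 0 x = x. Proof. by case: S_C0. Qed.
Let SD r s x : 0 <= r -> 0 <= s -> S (r + s) x = S r (S s x).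
Proof. by case: S_C0 => _ _ + _; exact. Qed.

Let S_near0 x e : 0 < e -> exists2 d : R, 0 < d & forall r, 0 <= r < d -> `|S r x - x| < e.
Proof.
move=> e0; have [_ _ _ /(_ x)/cvgrPdist_lt/(_ _ e0)] := S_C0.
move=> [d /= d0 dS]; exists d => // r /andP[].
rewrite le_eqVlt => /predU1P[<- _|r0 rd]; first by rewrite S0 subrr normr0.
by rewrite distrC; apply: dS => //=; rewrite sub0r normrN gtr0_norm.
Qed.

Let S_bounded_near0 : exists2 d : R, 0 < d & exists2 M : R, 1 <= M &
  forall r, 0 <= r <= d -> forall x, `|S r x| <= M * `|x|.
Proof.
apply: contrapT => nbd.
have /choice[r_ r_P] (n : nat) : exists r, 0 <= r <= n.+1%:R^-1 /\
    exists x, ~ `|S r x| <= n.+1%:R * `|x|.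
  apply: contrapT => nr; apply: nbd; exists n.+1%:R^-1; first by rewrite invr_gt0.
  exists n.+1%:R; first by rewrite ler1n.
  move=> r rn x; apply: contrapT => nx; apply: nr; exists r; split=> //.
  by exists x.
pose F := [set (S (r_ n) : E -> E) | n in setT].
have r_ge0 n : 0 <= r_ n by have [/andP[]] := r_P n.
have Flin f : F f -> bounded_fun_norm f /\ linear f.
  move=> [n _ <-]; split; last exact: linearP.
  have [M M0 SM] := continuous_linear_bounded (S_continuous (r_ge0 n)).
  move=> r; exists (M * r) => x xr.
  by rewrite (le_trans (SM x))// ler_wpM2l// ltW.
have Fpt : pointwise_bounded F.
  move=> x; have [d d0 Sd] := S_near0 x ltr01.
  have [N Nd] : exists N : nat, N.+1%:R^-1 < d.
    exists (Num.truncn d^-1); rewrite invf_plt ?posrE//.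
    by rewrite truncnS_gt.
  exists (`|x| + 1 + \sum_(n < N) `|S (r_ n) x|) => _ [n _ <-].
  have [nN|Nn] := ltnP n N.
    rewrite (bigD1 (Ordinal nN))//= addrCA lerDl addr_ge0 ?addr_ge0//.
    by rewrite sumr_ge0.
  have rd : r_ n < d.
    have [/andP[_ rn] _] := r_P n; apply: (le_lt_trans rn); apply: le_lt_trans Nd.
    by rewrite lef_pV2 ?posrE// ler_nat.
  have := Sd (r_ n); rewrite r_ge0 rd => /(_ isT) Sx.
  rewrite -[leLHS]addr0 lerD ?sumr_ge0//.
  rewrite -[S (r_ n) x](subrK x) (le_trans (ler_normD _ _))// addrC lerD2l.
  exact: ltW.
have [M FM] := Banach_Steinhauss Flin Fpt 1.
pose n := Num.truncn M.
have Mn : M < n.+1%:R by rewrite truncnS_gt.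
have [_ [x]] := r_P n; apply.
have [->|x0] := eqVneq x 0; first by rewrite linear0 !normr0 mulr0.
have nx0 : 0 < `|x| by rewrite normr_gt0.
rewrite -ler_pdivrMr// mulrC -[X in X * _]gtr0_norm ?invr_gt0// -normrZ -linearZ.
apply: le_trans (ltW Mn); apply: (FM (S (r_ n))); first by exists n.
by rewrite normrZ gtr0_norm ?invr_gt0// mulVf// gt_eqF.
Qed.

Lemma C0_semigroup_bounded T : exists2 M : R, 1 <= M &
  forall r, 0 <= r <= T -> forall x, `|S r x| <= M * `|x|.
Proof.
have [d d0 [M M1 SM]] := S_bounded_near0.
have SMk (k : nat) r x : 0 <= r <= k%:R * d -> `|S r x| <= M ^+ k * `|x|.
  elim: k r x => [|k IH] r x.
    by rewrite mul0r => /le_anti <-; rewrite S0 expr0 mul1r.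
  move=> /andP[r0 rk]; have [rd|dr] := leP r d.
    rewrite (le_trans (SM _ _ _))// ?r0// ler_wpM2r// ler_eXnr//.
  have rd : 0 <= r - d by rewrite subr_ge0 ltW.
  rewrite -(subrK d r) SD// ?(ltW d0)//.
  rewrite (le_trans (IH _ _ _))//.
    by rewrite rd lerBlDr; move: rk; rewrite -natr1 mulrDl mul1r.
  rewrite exprSr -mulrA ler_wpM2l ?exprn_ge0 ?(le_trans ler01)// SM//.
  by rewrite lexx ltW.
exists (M ^+ (Num.truncn (T / d)).+1); first by rewrite exprn_ege1.
move=> r /andP[r0 rT] x; apply: SMk; rewrite r0 (le_trans rT)//.
by rewrite -ler_pdivrMr// ltW// truncnS_gt.
Qed.

Lemma C0_semigroup_continuous x : continuous (fun r : R => S (Num.max 0 r) x).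
Proof.
move=> r; apply/cvgrPdist_lt => e e0.
have [M M1 SM] := C0_semigroup_bounded (Num.max 0 r + 1).
have M0 : 0 < M by rewrite (lt_le_trans ltr01).
have [d d0 Sd] := S_near0 x (divr_gt0 e0 M0).
have step a b : 0 <= a -> a <= b -> a <= Num.max 0 r + 1 -> b - a < d -> `|S a x - S b x| < e.
  move=> a0 ab ar bad; have ba0 : 0 <= b - a by rewrite subr_ge0.
  rewrite -{1}(subrK a b) (addrC (b - a)) SD// -linearB (le_lt_trans (SM _ _ _))// ?a0//.
  rewrite -ltr_pdivlMl// mulrC distrC Sd// ba0//.
near=> s.
have rs : `|Num.max 0 r - Num.max 0 s| < d /\ Num.max 0 s <= Num.max 0 r + 1.
  have : `|r - s| < Num.min d 1.
    by near: s; exists (Num.min d 1) => //=; rewrite lt_min d0 ltr01.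
  rewrite lt_min !ltr_norml /Num.max.
  by case: ifP => [|/negbT]; case: ifP => [|/negbT]; rewrite -?leNgt; lra.
have r0 : 0 <= Num.max 0 r by rewrite le_max lexx.
have s0 : 0 <= Num.max 0 s by rewrite le_max lexx.
move: rs; set a := Num.max 0 r in step r0 *; set b := Num.max 0 s in s0 *.
move=> [abd ba]; have [ab|/ltW ab] := leP a b.
  by apply: step => //; [rewrite lerDl|rewrite (le_lt_trans _ abd)// distrC ler_norm].
by rewrite distrC; apply: step => //; rewrite (le_lt_trans _ abd)// ler_norm.
Unshelve. all: by end_near. Qed.

End c0_semigroups.

(** * The covariance of the measures mu_t *)

Section covariance.
Context (R : realType) (E H : completeNormedModType R) (ip : {dot H for idfun}).
Hypothesis ip_norm : forall h : H, ip h h = `|h| ^+ 2.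
Variable S : R -> {linear E -> E}.
Hypothesis S_C0 : C0_semigroup S.
Variable B : {linear H -> E}.
Hypothesis B_cont : continuous B.
Implicit Types (r s t h M T : R) (xs : {linear E -> R^o}).
Notation leb := (@lebesgue_measure R).
Notation cov := (cov_pairing ip S B).

Let ipC (h k : H) : ip h k = ip k h.
Proof. by rewrite (@hermC _ _ _ _ ip) expr0 mul1r. Qed.

Let normB (h k : H) : `|h - k| ^+ 2 = `|h| ^+ 2 - 2 * ip h k + `|k| ^+ 2.
Proof.
have ipDr (x y z : H) : ip x (y + z) = ip x y + ip x z by exact: linearDr.
have ipNr (x y : H) : ip x (- y) = - ip x y by exact: linearNr.
rewrite -!ip_norm ipDr ipNr !(ipC (h - k)) !ipDr !ipNr (ipC k h).
by ring.
Qed.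

Let cov_integrand xs r := xs (S r (BBadj ip B (xs \o S r))).

Let adjointE xs r k : continuous xs -> 0 <= r ->
  ip (adjoint ip B (xs \o S r)) k = xs (S r (B k)).
Proof.
move=> xs_cont r0; have [S_cont _ _ _] := S_C0.
apply: (@rieszE _ _ _ ip_norm (xs \o S r \o B)).
move=> x; apply: continuous_comp; first exact: B_cont.
by apply: continuous_comp; [exact: S_cont|exact: xs_cont].
Qed.

Let cov_integrandE xs r : continuous xs -> 0 <= r ->
  cov_integrand xs r = `|adjoint ip B (xs \o S r)| ^+ 2.
Proof. by move=> xs_cont r0; rewrite -ip_norm adjointE. Qed.

(* |h|^2 = max_k (2 <h, k> - |k|^2), which exhibits the integrand as a supremum
   of continuous functions of r. *)
Let cov_integrand_gt xs r a : continuous xs -> 0 <= r ->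
  a < cov_integrand xs r <-> exists k, a < 2 * xs (S r (B k)) - `|k| ^+ 2.
Proof.
move=> xs_cont r0; rewrite cov_integrandE//; set h := adjoint _ _ _.
split=> [ah|[k]].
  by exists h; rewrite -adjointE// -/h ip_norm; lra.
rewrite -adjointE// -/h => /lt_le_trans; apply.
by have := sqr_ge0 `|h - k|; rewrite normB; lra.
Qed.

Let measurable_cov_integrand xs : continuous xs ->
  measurable_fun setT (fun r => cov_integrand xs (Num.max 0 r)).
Proof.
move=> xs_cont; apply/measurable_EFinP; apply: lower_semicontinuous_measurable.
apply/lower_semicontinuousP => a.
rewrite (_ : [set _ | _] = \bigcup_(k in setT)
    [set r : R | a < 2 * xs (S (Num.max 0 r) (B k)) - `|k| ^+ 2]); last first.
  apply/seteqP; split=> r /=; rewrite lte_fin.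
    by move=> /cov_integrand_gt[]//; [rewrite le_max lexx|move=> k ak; exists k].
  by move=> [k _ ak]; apply/cov_integrand_gt => //; [rewrite le_max lexx|exists k].
apply: bigcup_open => k _.
apply: (@open_comp _ _ (fun r : R => 2 * xs (S (Num.max 0 r) (B k)) - `|k| ^+ 2)
  [set y | a < y]); last exact: open_gt.
move=> r _; apply: (@cvgB _ R^o); last exact: cvg_cst.
apply: (@cvgM _ _ (nbhs r)); first exact: cvg_cst.
apply: (@continuous_comp _ _ _ (fun r : R => S (Num.max 0 r) (B k)) xs).
  exact: C0_semigroup_continuous.
exact: xs_cont.
Qed.

Let cov_integrand_bounded xs T : continuous xs ->
  exists M, forall r, 0 <= r <= T -> `|cov_integrand xs r| <= M.
Proof.
move=> xs_cont.
have [C C0 xsC] := continuous_linear_bounded xs_cont.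
have [D D0 BD] := continuous_linear_bounded B_cont.
have [N N1 SN] := C0_semigroup_bounded S_C0 T.
have N0 : 0 < N by rewrite (lt_le_trans ltr01).
exists ((C * N * D) ^+ 2) => r rT; have /andP[r0 _] := rT.
rewrite cov_integrandE// ger0_norm ?sqr_ge0//.
set h := adjoint _ _ _.
have hh : `|h| ^+ 2 <= C * N * D * `|h|.
  rewrite -ip_norm adjointE// (le_trans (ler_norm _))//.
  rewrite (le_trans (xsC _))// -!mulrA ler_wpM2l// ?(ltW C0)//.
  by rewrite (le_trans (SN _ rT _))// ler_wpM2l// ltW.
have [->|h0] := eqVneq h 0.
  by rewrite normr0 expr0n/= sqr_ge0.
have nh : 0 < `|h| by rewrite normr_gt0.
have : `|h| <= C * N * D by rewrite -(ler_pM2r nh) -expr2.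
by rewrite -ler_sqr ?nnegrE// !mulr_ge0 ?ltW.
Qed.

Let cov_pairingE xs t :
  cov t xs xs = \int[leb]_(r in `[0, t]) cov_integrand xs (Num.max 0 r).
Proof.
apply: eq_Rintegral => r; rewrite inE/= in_itv/= => /andP[r0 _].
by rewrite max_r.
Qed.

Lemma cov_pairing_ge0 xs t : continuous xs -> 0 <= cov t xs xs.
Proof.
move=> xs_cont; rewrite cov_pairingE; apply: Rintegral_ge0 => r _.
by rewrite cov_integrandE ?sqr_ge0// le_max lexx.
Qed.

Lemma cov_pairing_le xs T : continuous xs ->
  exists M, forall t, 0 <= t <= T -> cov t xs xs <= M * t.
Proof.
move=> xs_cont; have [M FM] := cov_integrand_bounded T xs_cont.
exists M => t /andP[t0 tT]; rewrite cov_pairingE.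
have := @le_normr_Rintegral_bounded _ (measurableTypeR R) _ leb `[0, t]
  (fun r => cov_integrand xs (Num.max 0 r)) M.
have -> : fine (leb `[0, t]) = t.
  rewrite lebesgue_measure_itv/= lte_fin.
  by case: ltgtP t0 => // <- _; rewrite ?oppr0 ?adde0.
move=> HM; apply: le_trans (HM _ _ _ _) => //; first exact: ler_norm.
- exact: lebesgue_measure_itvcc_lty.
- by apply: measurable_funTS; exact: measurable_cov_integrand.
- move=> r /=; rewrite in_itv/= => /andP[r0 rt]; rewrite max_r//.
  by apply: FM; rewrite r0 (le_trans rt).
Qed.

Lemma cov_pairingD xs r h : continuous xs -> 0 <= r -> 0 <= h ->
  cov (r + h) xs xs = cov r xs xs + cov h (xs \o S r) (xs \o S r).
Proof.
move=> xs_cont r0 h0; have [S_cont _ SD _] := S_C0.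
have [M FM] := cov_integrand_bounded (r + h) xs_cont.
have mF := measurable_cov_integrand xs_cont.
rewrite !cov_pairingE.
rewrite [X in _ = _ + X](_ : _ =
    \int[leb]_(u in `[0, h]) cov_integrand xs (Num.max 0 (u + r))); last first.
  apply: eq_Rintegral => u; rewrite inE/= in_itv/= => /andP[u0 _].
  rewrite !max_r ?addr_ge0// /cov_integrand.
  have -> : ((xs \o S r) \o S u : E -> R) = xs \o S (u + r).
    by apply/funext => x /=; rewrite addrC SD.
  by rewrite /= addrC SD.
have := @Rintegral_itv_shift _ (fun u => cov_integrand xs (Num.max 0 u)) r 0 h M.
move=> /= ->//; last first.
  move=> u /andP[u0 uh]; rewrite max_r ?addr_ge0//.
  by apply: FM; rewrite addr_ge0//= addrC lerD2l.
have intF : leb.-integrable `[0, r + h] (EFin \o (fun u => cov_integrand xs (Num.max 0 u))).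
  apply: (@integrable_bounded _ (measurableTypeR R) _ leb _ _ M) => //.
  - exact: lebesgue_measure_itvcc_lty.
  - exact: measurable_funTS.
  - by move=> u /=; rewrite in_itv/= => /andP[u0 urh]; rewrite max_r// FM// u0.
rewrite add0r (addrC h) -(@Rintegral_itv_obnd_cbnd _ r); last first.
  apply: integrableS intF => // u /=; rewrite !in_itv/= => /andP[ru ->].
  by rewrite andbT (le_trans r0)// ltW.
rewrite -(@Rintegral_itvB _ _ (BLeft 0) (BRight (r + h)) r intF).
- by rewrite [RHS]addrC subrK.
- by rewrite bnd_simp.
- by rewrite bnd_simp lerDl.
Qed.

End covariance.

(** * Trigonometric polynomials *)

Section trigonometric_polynomials.
Context (R : realType) (E : normedModType R).
Implicit Types (f g : E -> R) (c b : R) (xs ys : {linear E -> R^o}).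

(* The phase b makes sines superfluous. *)
Inductive trig_poly : (E -> R) -> Prop :=
| trig_poly_cos c b xs of continuous xs : trig_poly (fun x => c * cos (xs x + b))
| trig_polyD f g of trig_poly f & trig_poly g : trig_poly (f \+ g).

Lemma trig_poly_cst c : trig_poly (fun=> c).
Proof.
rewrite (_ : (fun=> c) = fun x => c * cos ((\0 : {linear E -> R^o}) x + 0)).
  by apply: trig_poly_cos => x; exact: cvg_cst.
by apply/funext => x; rewrite /= addr0 cos0 mulr1.
Qed.

Lemma trig_polyZ c f : trig_poly f -> trig_poly (fun x => c * f x).
Proof.
elim=> [d b xs xs_cont|g h _ cg _ ch].
  rewrite (_ : (fun x => _) = fun x => c * d * cos (xs x + b)); first exact: trig_poly_cos.
  by apply/funext => x; rewrite mulrA.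
rewrite (_ : (fun x => _) = (fun x => c * g x) \+ (fun x => c * h x)).
  exact: trig_polyD.
by apply/funext => x /=; rewrite mulrDr.
Qed.

Lemma trig_polyM f g : trig_poly f -> trig_poly g -> trig_poly (f \* g).
Proof.
move=> tf; elim=> [d b' ys ys_cont|g1 g2 _ t1 _ t2]; last first.
  rewrite (_ : _ \* _ = (f \* g1) \+ (f \* g2)); first exact: trig_polyD.
  by apply/funext => x /=; rewrite mulrDr.
elim: tf => [c b xs xs_cont|f1 f2 _ t1 _ t2]; last first.
  rewrite (_ : _ \* _ = (f1 \* (fun x => d * cos (ys x + b'))) \+
    (f2 \* (fun x => d * cos (ys x + b')))); first exact: trig_polyD.
  by apply/funext => x /=; rewrite mulrDl.
rewrite (_ : _ \* _ =
   (fun x => c * d / 2 * cos ((xs \+ ys) x + (b + b'))) \+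
   (fun x => c * d / 2 * cos ((xs \- ys) x + (b - b')))).
  apply: trig_polyD; apply: trig_poly_cos => x.
    by apply: (@cvgD _ R^o); [exact: xs_cont|exact: ys_cont].
  by apply: (@cvgB _ R^o); [exact: xs_cont|exact: ys_cont].
have key (u v : R) : c * cos u * (d * cos v) =
    c * d / 2 * cos (u + v) + c * d / 2 * cos (u - v).
  by rewrite (cosD u v) (cosB u v); field.
apply/funext => x /=.
have -> : xs x + ys x + (b + b') = (xs x + b) + (ys x + b') by rewrite addrACA.
have -> : xs x - ys x + (b - b') = (xs x + b) - (ys x + b') by rewrite addrACA -opprD.
exact: key.
Qed.

Lemma trig_poly_bounded f : trig_poly f -> exists M, forall x, `|f x| <= M.
Proof.
elim=> [c b xs _|g h _ [M gM] _ [N hN]].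
  by exists `|c| => x; rewrite normrM ler_piMr// cos_max.
exists (M + N) => x /=.
by rewrite (le_trans (ler_normD _ _))// lerD.
Qed.

Lemma trig_poly_lipschitz f : trig_poly f ->
  exists2 L : R, 0 <= L & forall x y, `|f x - f y| <= L * `|x - y|.
Proof.
elim=> [c b xs xs_cont|g h _ [M M0 gM] _ [N N0 hN]].
  have [C C0 xsC] := continuous_linear_bounded xs_cont.
  exists (`|c| * C) => [|x y]; first by rewrite mulr_ge0// ltW.
  rewrite -mulrBr normrM -mulrA ler_wpM2l//.
  rewrite (le_trans (dist_cos_le _ _))// opprD addrACA subrr addr0.
  by rewrite -[xs x - xs y]/(xs x - xs y) -(linearB xs x y) xsC.
exists (M + N) => [|x y]; first exact: addr_ge0.
by rewrite /= opprD addrACA (le_trans (ler_normD _ _))// mulrDl lerD.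
Qed.

Lemma lipschitz_continuous f (L : R) : 0 <= L ->
  (forall x y, `|f x - f y| <= L * `|x - y|) -> continuous (f : E -> R^o).
Proof.
move=> L0 fL x; apply/cvgrPdist_lt => e e0.
have L1 : 0 < L + 1 by lra.
near=> y.
rewrite (le_lt_trans (fL _ _))// (@le_lt_trans _ _ ((L + 1) * `|x - y|))//.
  by rewrite ler_wpM2r// lerDl.
rewrite -ltr_pdivlMl// mulrC.
near: y; exact: (@cvgr_dist_lt _ _ _ (nbhs x) _ id x cvg_id _ (divr_gt0 e0 L1)).
Unshelve. all: by end_near. Qed.

Lemma trig_poly_continuous f : trig_poly f -> continuous (f : E -> R^o).
Proof. by case/trig_poly_lipschitz => L; exact: lipschitz_continuous. Qed.

End trigonometric_polynomials.

Section borel_integrals.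
Context (R : realType) (E : completeNormedModType R).
Variables (nu : probability (borel E) R).
Implicit Types (f g : E -> R) (a : E) (M : R).

Lemma continuous_measurable_borel f : continuous (f : E -> R^o) ->
  measurable_fun [set: borel E] (f : borel E -> R).
Proof.
move=> cf; apply: (measurability _ (RGenOpens.measurableE R)).
move=> _ [_ [a [b ->] <-]]; rewrite setTI; apply: sub_sigma_algebra.
apply: (@open_comp _ _ (f : E -> R^o)); last exact: interval_open.
by move=> x _; exact: cf.
Qed.

Lemma continuous_shift f a : continuous (f : E -> R^o) ->
  continuous (fun y => f (a + y) : R^o).
Proof.
move=> cf x; apply: (@continuous_comp _ _ _ (fun y => a + y) (f : E -> R^o)); last exact: cf.
exact: (@cvgD _ E _ (nbhs x) _ (cst a) id a x (cvg_cst a) cvg_id).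
Qed.

Lemma integrable_continuous_bounded f M a : continuous (f : E -> R^o) ->
  (forall x, `|f x| <= M) ->
  nu.-integrable setT (EFin \o (fun y : borel E => f (a + (y : E)))).
Proof.
move=> cf fM; apply: (@integrable_bounded _ _ _ _ _ _ M) => //.
- exact: fin_num_fun_lty.
- apply: continuous_measurable_borel; exact: continuous_shift.
Qed.

Lemma le_normr_Rintegral_continuous f M a : continuous (f : E -> R^o) ->
  (forall x, `|f x| <= M) -> `|\int[nu]_y f (a + (y : E))| <= M.
Proof.
move=> cf fM.
apply: (@le_trans _ _ (M * fine (nu setT))).
  apply: le_normr_Rintegral_bounded => //; first exact: fin_num_fun_lty.
  by apply: continuous_measurable_borel; exact: continuous_shift.
by rewrite (congr1 fine (probability_setT nu)) mulr1.
Qed.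

End borel_integrals.

Section ornstein_uhlenbeck_trig_poly.
Context (R : realType) (E H : completeNormedModType R) (ip : {dot H for idfun}).
Hypothesis ip_norm : forall h : H, ip h h = `|h| ^+ 2.
Variable S : R -> {linear E -> E}.
Hypothesis S_C0 : C0_semigroup S.
Variable B : {linear H -> E}.
Hypothesis B_cont : continuous B.
Variable mu : R -> probability (borel E) R.
Hypothesis mu_gauss :
  forall r : R, 0 <= r -> gaussian_radon (mu r) (cov_pairing ip S B r).
Implicit Types (r s t h M T c b : R) (f g : E -> R) (xs : {linear E -> R^o}).
Notation cov := (cov_pairing ip S B).
Notation P := (OU S mu).

Let S_continuous r : 0 <= r -> continuous (S r). Proof. by case: S_C0 => + _ _ _; exact. Qed.

Lemma OU_cos c b xs r x : continuous xs -> 0 <= r ->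
  P r (fun x => c * cos (xs x + b)) x =
  c * gauss_cf (cov r xs xs) * cos (xs (S r x) + b).
Proof.
move=> xs_cont r0; rewrite /OU.
have -> : \int[mu r]_y (c * cos (xs (S r x + (y : E)) + b)) =
    \int[mu r]_y (c * cos (xs y + (xs (S r x) + b))).
  by apply: eq_Rintegral => y _; rewrite linearD /= addrA (addrC (xs y)).
rewrite RintegralZl//.
  rewrite (Rintegral_cos_gaussian (v := cov r xs xs)) ?mulrA//.
  - exact: cov_pairing_ge0.
  - exact: continuous_measurable_borel.
  - by have [_] := mu_gauss r0; apply.
apply: (@integrable_bounded _ _ _ _ _ _ 1) => //.
- exact: fin_num_fun_lty.
- apply: measurableT_comp; first exact: measurable_cos.
  by apply: measurable_funD => //; exact: continuous_measurable_borel.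
- by move=> x' _; exact: cos_max.
Qed.

Lemma OU_add f g r : trig_poly f -> trig_poly g -> P r (f \+ g) = P r f \+ P r g.
Proof.
move=> tf tg; apply/funext => x; rewrite /OU /=.
have [M fM] := trig_poly_bounded tf; have [N gN] := trig_poly_bounded tg.
apply: RintegralD => //.
- exact: integrable_continuous_bounded (trig_poly_continuous tf) fM.
- exact: integrable_continuous_bounded (trig_poly_continuous tg) gN.
Qed.

Lemma OU_trig_poly f r : trig_poly f -> 0 <= r -> trig_poly (P r f).
Proof.
move=> + r0; elim=> [c b xs xs_cont|f1 f2 t1 IH1 t2 IH2]; last first.
  by rewrite OU_add//; exact: trig_polyD.
rewrite (_ : P r _ = fun x => c * gauss_cf (cov r xs xs) * cos ((xs \o S r) x + b)).
  apply: trig_poly_cos => x.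
  by apply: continuous_comp; [exact: S_continuous|exact: xs_cont].
by apply/funext => x; rewrite OU_cos.
Qed.

(* The identity of covariances Q_(r + h) = Q_r + S(r) Q_h S(r)^* makes the
   semigroup property a computation on characteristic functions. *)
Lemma OU_semigroup f h r : trig_poly f -> 0 <= h -> 0 <= r ->
  P h (P r f) = P (h + r) f.
Proof.
move=> + h0 r0; elim=> [c b xs xs_cont|f1 f2 t1 IH1 t2 IH2]; last first.
  by rewrite !OU_add ?IH1 ?IH2//; exact: OU_trig_poly.
have xsS_cont : continuous (xs \o S r).
  by move=> x; apply: continuous_comp; [exact: S_continuous|exact: xs_cont].
apply/funext => x; rewrite (OU_cos _ _ _ xs_cont) ?addr_ge0//.
rewrite (_ : P r _ = fun x =>
    c * gauss_cf (cov r xs xs) * cos ((xs \o S r) x + b)); last first.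
  by apply/funext => y; rewrite OU_cos.
rewrite OU_cos//= (addrC h) (cov_pairingD ip_norm S_C0 B_cont)//.
rewrite gauss_cfD ?mulrA//; last 2 first.
- exact: cov_pairing_ge0.
- exact: (cov_pairing_ge0 ip_norm S_C0 B_cont (xs := xs \o S r)).
by have [_ _ SD _] := S_C0; rewrite SD.
Qed.

Lemma OU_cvg0 f x : trig_poly f -> P h f x @[h --> 0^'+] --> f x.
Proof.
elim=> [c b xs xs_cont|f1 f2 t1 IH1 t2 IH2]; last first.
  rewrite (_ : (fun h => _) = (fun h => P h f1 x + P h f2 x)).
    exact: cvgD.
  by apply/funext => h; rewrite OU_add.
have [M covM] := cov_pairing_le ip_norm S_C0 B_cont 1 xs_cont.
have cf1 : gauss_cf (cov h xs xs) @[h --> 0^'+] --> (1 : R).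
  apply/cvgrPdist_le => e e0.
  have M1 : 0 < 4 * (`|M| + 1) by rewrite mulr_gt0// ltr_wpDl.
  near=> h.
  have h0 : 0 <= h by near: h; exact: nbhs_right_ge.
  apply: le_trans (gauss_cf_near1 (cov_pairing_ge0 ip_norm S_C0 B_cont h xs_cont)) _.
  have h1 : h <= 1 by near: h; exact: nbhs_right_le.
  have : h <= e / (4 * (`|M| + 1)) by near: h; apply: nbhs_right_le; rewrite divr_gt0.
  rewrite ler_pdivlMr//.
  have := covM h; rewrite h0 h1 => /(_ isT); have := ler_norm M; nra.
have Sx : cos (xs (S h x) + b) @[h --> 0^'+] --> cos (xs x + b).
  apply: continuous_cvg; first exact: continuous_cos.
  apply: (@cvgD _ R^o); last exact: cvg_cst.
  have [_ _ _ /(_ x) Sx0] := S_C0.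
  by apply: (cvg_comp _ _ Sx0); exact: xs_cont.
have : c * gauss_cf (cov h xs xs) * cos (xs (S h x) + b) @[h --> 0^'+] -->
    c * 1 * cos (xs x + b).
  by apply: cvgM => //; apply: cvgM => //; exact: cvg_cst.
rewrite mulr1; apply: cvg_trans; apply: near_eq_cvg.
near=> h; rewrite OU_cos//; near: h; exact: nbhs_right_ge.
Unshelve. all: by end_near. Qed.

Lemma OU_right_continuous f x r : trig_poly f -> 0 <= r ->
  P (h + r) f x @[h --> 0^'+] --> P r f x.
Proof.
move=> tf r0; have := @OU_cvg0 _ x (OU_trig_poly tf r0).
apply: cvg_trans; apply: near_eq_cvg; near=> h.
by rewrite OU_semigroup//; near: h; exact: nbhs_right_ge.
Unshelve. all: by end_near. Qed.

Lemma OU_le f M r x : continuous (f : E -> R^o) -> (forall x, `|f x| <= M) -> `|P r f x| <= M.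
Proof. by move=> cf fM; exact: le_normr_Rintegral_continuous. Qed.

End ornstein_uhlenbeck_trig_poly.

(** * Uniform approximation by trigonometric polynomials *)

Section stone_weierstrass.
Context (R : realType) (E : normedModType R).
Implicit Types (f g : E -> R) (a e : R) (K : set E).

Definition trig_limit f :=
  forall e, 0 < e -> exists2 p, trig_poly p & forall x, `|f x - p x| <= e.

Lemma trig_poly_limit f : trig_poly f -> trig_limit f.
Proof. by move=> tf e e0; exists f => // x; rewrite subrr normr0 ltW. Qed.

Lemma trig_limit_limit f :
  (forall e, 0 < e -> exists2 g, trig_limit g & forall x, `|f x - g x| <= e) ->
  trig_limit f.
Proof.
move=> fP e e0; have e20 : 0 < e / 2 by rewrite divr_gt0.
have [g /(_ _ e20)[p tp gp] fg] := fP _ e20.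
exists p => // x; rewrite -(subrKA (g x)) (le_trans (ler_normD _ _))//.
by rewrite [leRHS]splitr lerD.
Qed.

Lemma trig_limitD f g : trig_limit f -> trig_limit g -> trig_limit (f \+ g).
Proof.
move=> fP gP e e0; have e20 : 0 < e / 2 by rewrite divr_gt0.
have [p tp fp] := fP _ e20; have [q tq gq] := gP _ e20.
exists (p \+ q); first exact: trig_polyD.
by move=> x /=; rewrite opprD addrACA (le_trans (ler_normD _ _))// [leRHS]splitr lerD.
Qed.

Lemma trig_limitZ a f : trig_limit f -> trig_limit (fun x => a * f x).
Proof.
move=> fP e e0; have a0 : 0 < `|a| + 1 by rewrite ltr_wpDl.
have [p tp fp] := fP _ (divr_gt0 e0 a0).
exists (fun x => a * p x); first exact: trig_polyZ.
move=> x; rewrite -mulrBr normrM.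
rewrite (@le_trans _ _ ((`|a| + 1) * (e / (`|a| + 1))))//; last first.
  by rewrite mulrC divfK// gt_eqF.
by rewrite ler_pM// lerDl.
Qed.

Lemma trig_limit_continuous f : trig_limit f -> continuous (f : E -> R^o).
Proof.
move=> fP x; apply/cvgrPdist_le => e e0; have e30 : 0 < e / 3 by rewrite divr_gt0.
have [p tp fp] := fP _ e30.
have pc := trig_poly_continuous tp.
have := pc x => /cvgrPdist_le/(_ _ e30) px.
near=> y.
have pxy : `|p x - p y| <= e / 3 by near: y.
have := fp x; have := fp y; move: pxy; rewrite !ler_norml; lra.
Unshelve. all: by end_near. Qed.

Fixpoint sqrt_sqr_approx n (u : R) : R :=
  if n is m.+1 then
    let s := sqrt_sqr_approx m u in s + (u ^+ 2 - s ^+ 2) / 2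
  else 0.

Lemma sqrt_sqr_approxP n (u : R) : `|u| <= 1 ->
  [/\ 0 <= sqrt_sqr_approx n u, sqrt_sqr_approx n u <= `|u| &
    `|u| - sqrt_sqr_approx n u <= `|u| * (1 - `|u| / 2) ^+ n].
Proof.
have u2 : u ^+ 2 = `|u| ^+ 2 by rewrite real_normK ?num_real.
move: (normr_ge0 u) u2; set w := `|u| => w0 u2 w1.
elim: n => [|n [s0 sw IH]] /=; first by rewrite expr0 mulr1 subr0; split.
set s := sqrt_sqr_approx n u in s0 sw IH *; rewrite u2.
split; [nra|nra|].
rewrite [X in _ <= _ * X]exprSr mulrA; apply: (@le_trans _ _ ((w - s) * (1 - w / 2))); first nra.
by rewrite ler_wpM2r//; lra.
Qed.

Lemma expr_onem_mul_le n (x : R) : 0 <= x <= 1 -> (1 - x) ^+ n * (1 + n%:R * x) <= 1.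
Proof.
move=> /andP[x0 x1]; elim: n => [|n IH]; first by rewrite expr0 mul0r addr0 mulr1.
apply: le_trans IH; rewrite exprSr -mulrA ler_wpM2l ?exprn_ge0 ?subr_ge0//.
have n0 : (0 : R) <= n%:R by exact: ler0n.
rewrite -natr1; nra.
Qed.

Lemma sqrt_sqr_approx_cvg n (u : R) : `|u| <= 1 ->
  `| `|u| - sqrt_sqr_approx n.+1 u| <= 2 / n.+1%:R.
Proof.
move=> u1; have [_ su us] := sqrt_sqr_approxP n.+1 u1.
rewrite ger0_norm ?subr_ge0// (le_trans us)// ler_pdivlMr//.
have w0 := normr_ge0 u; set w := `|u| in w0 u1 *.
have := @expr_onem_mul_le n.+1 (w / 2).
have -> : 0 <= w / 2 <= 1 by apply/andP; split; lra.
move=> /(_ isT); set c := _ ^+ n.+1; have c0 : 0 <= c by rewrite exprn_ge0//; lra.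
set m := n.+1%:R; lra.
Qed.

Lemma trig_poly_sqrt_sqr_approx n f : trig_poly f ->
  trig_poly (fun x => sqrt_sqr_approx n (f x)).
Proof.
move=> tf; elim: n => [|n IH]; first exact: trig_poly_cst.
rewrite (_ : (fun x => _) = (fun x => sqrt_sqr_approx n (f x)) \+
  ((fun x => 2^-1 * (f \* f) x) \+
   (fun x => (- 2^-1) * ((fun x => sqrt_sqr_approx n (f x)) \*
                         (fun x => sqrt_sqr_approx n (f x))) x))).
  by do !apply: trig_polyD => //; apply: trig_polyZ; exact: trig_polyM.
by apply/funext => x /=; rewrite !expr2; field.
Qed.

Lemma trig_limit_norm f : trig_limit f -> trig_limit (fun x => `|f x|).
Proof.
move=> fP; apply: trig_limit_limit => e e0.
have [p tp fp] := fP _ e0; exists (fun x => `|p x|); last first.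
  by move=> x; rewrite (le_trans (ler_dist_dist _ _)).
have [M pM] := trig_poly_bounded tp.
have M0 : 0 < `|M| + 1 by rewrite ltr_wpDl.
pose u x := (`|M| + 1)^-1 * p x.
have u1 x : `|u x| <= 1.
  rewrite /u normrM normfV (gtr0_norm M0) ler_pdivrMl// mulr1 (le_trans (pM x))//.
  by rewrite (le_trans (ler_norm M))// lerDl.
move=> d d0.
have d1 : 0 < d / (2 * (`|M| + 1)) by rewrite divr_gt0// mulr_gt0.
pose n := Num.truncn (d / (2 * (`|M| + 1)))^-1.
have nd : n.+1%:R^-1 <= d / (2 * (`|M| + 1)).
  by rewrite invf_ple ?posrE// ltW// truncnS_gt.
exists (fun x => (`|M| + 1) * sqrt_sqr_approx n.+1 (u x)).
  by apply: trig_polyZ; apply: trig_poly_sqrt_sqr_approx; exact: trig_polyZ.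
move=> x; have := sqrt_sqr_approx_cvg n (u1 x).
have -> : `|p x| = (`|M| + 1) * `|u x|.
  by rewrite /u normrM normfV (gtr0_norm M0) mulrA divff ?mul1r// gt_eqF.
have distM (b c : R) : `|(`|M| + 1) * b - (`|M| + 1) * c| = (`|M| + 1) * `|b - c|.
  by rewrite -mulrBr normrM gtr0_norm.
rewrite distM => H.
have : (`|M| + 1) * (2 / n.+1%:R) <= d.
  by move: nd; rewrite ler_pdivlMr ?mulr_gt0// mulrC mulrCA mulrA.
by apply: le_trans; rewrite ler_wpM2l// ltW.
Qed.

Lemma trig_limit_max f g : trig_limit f -> trig_limit g ->
  trig_limit (fun x => Num.max (f x) (g x)).
Proof.
move=> fP gP.
rewrite (_ : (fun x => _) = (fun x => 2^-1 *
  ((f \+ g) \+ (fun x => `|(f \+ (fun x => (-1) * g x)) x|)) x)).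
  by do ?[apply: trig_limitZ|apply: trig_limitD|apply: trig_limit_norm].
by apply/funext => x /=; rewrite mulN1r maxr_absE mulrC.
Qed.

Lemma trig_limit_min f g : trig_limit f -> trig_limit g ->
  trig_limit (fun x => Num.min (f x) (g x)).
Proof.
move=> fP gP.
rewrite (_ : (fun x => _) =
  (fun x => (-1) * Num.max ((-1) * f x) ((-1) * g x))).
  by apply: trig_limitZ; apply: trig_limit_max; exact: trig_limitZ.
by apply/funext => x /=; rewrite !mulN1r -oppr_min opprK.
Qed.

Lemma trig_poly_separates x y : x != y ->
  exists2 p : E -> R, trig_poly p & p x = 2 /\ p y = - 2.
Proof.
move=> xy; have yx0 : y - x != 0 by rewrite subr_eq0 eq_sym.
have [xs [xs_cont xs0]] := continuous_functional_neq0 yx0.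
pose a : R := pi / xs (y - x).
pose zs : {linear E -> R^o} := a \*: xs.
exists (fun z => 2 * cos (zs z + - zs x)).
  apply: trig_poly_cos => z; apply: (@cvgM _ _ (nbhs z)); first exact: cvg_cst.
  exact: xs_cont.
split; first by rewrite subrr cos0 mulr1.
have -> : zs y + - zs x = pi.
  by rewrite -[LHS](linearB zs) /= -[LHS]/(pi / xs (y - x) * xs (y - x)) divfK.
by rewrite cospi mulrN1.
Qed.

Lemma compact_trig_limit_lt (Q : (E -> R) -> Prop) K a : compact K ->
    (exists f, Q f) -> (forall f, Q f -> trig_limit f) ->
    (forall f g, Q f -> Q g -> Q (fun x => Num.min (f x) (g x))) ->
    (forall y, K y -> exists2 f, Q f & f y < a) ->
  exists2 f, Q f & forall y, K y -> f y < a.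
Proof.
move=> cK Q0 Qlim Qmin Qlt; apply: contrapT => nQ.
pose G f := K `&` [set y | a <= f y].
have GG : ProperFilter (filter_from Q G).
  apply: filter_from_proper; last first.
    move=> f Qf; apply: contrapT => nf; apply: nQ; exists f => // y Ky.
    by rewrite ltNge; apply/negP => af; apply: nf; exists y.
  apply: filter_from_filter => // f g Qf Qg.
  exists (fun x => Num.min (f x) (g x)); first exact: Qmin.
  by move=> y [Ky]; rewrite /= le_min => /andP[].
have GK : filter_from Q G K by have [f Qf] := Q0; exists f => // y [].
have [y [Ky yG]] := cK _ GG GK.
have [f Qf fya] := Qlt _ Ky.
have fa : nbhs y [set z | f z < a].
  apply: (@trig_limit_continuous f (Qlim _ Qf) y [set u : R | u < a]).
  by apply: open_nbhs_nbhs; split => //; exact: open_lt.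
have [z [[_ /= az] /= za]] := yG (G f) _ (ex_intro2 _ _ f Qf (@subset_refl _ _)) fa.
by move: az; rewrite leNgt za.
Qed.

Lemma trig_limit_separates K1 K2 : compact K1 -> compact K2 -> K1 `&` K2 = set0 ->
  exists f, [/\ trig_limit f, forall x, K1 x -> 1 < f x & forall x, K2 x -> f x < -1].
Proof.
move=> cK1 cK2 K12.
have [->|/set0P[x1 K1x1]] := eqVneq K1 set0.
  by exists (fun=> -2); split=> // [|x _]; [exact/trig_poly_limit/trig_poly_cst|lra].
have step1 x : K1 x -> exists f, [/\ trig_limit f, 1 < f x & forall y, K2 y -> f y < -1].
  move=> K1x.
  have [|||y K2y|f [flim fx] fK2] := @compact_trig_limit_lt
      (fun f => trig_limit f /\ 1 < f x) K2 (-1) cK2.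
  - by exists (fun=> 2); split; [exact/trig_poly_limit/trig_poly_cst|lra].
  - by move=> f [].
  - move=> f g [flim fx] [glim gx]; split; first exact: trig_limit_min.
    by rewrite lt_min fx.
  - have xy : x != y.
      apply/eqP => xy; suff : (K1 `&` K2) x by rewrite K12.
      by split=> //; rewrite xy.
    have [p tp [px py]] := trig_poly_separates xy.
    by exists p; [split; [exact: trig_poly_limit|lra]|lra].
  by exists f.
have [|||x K1x|f [flim fK2] fK1] := @compact_trig_limit_lt
    (fun f => trig_limit f /\ forall y, K2 y -> 1 < f y) K1 (-1) cK1.
- by exists (fun=> 2); split=> [|y _]; [exact/trig_poly_limit/trig_poly_cst|lra].
- by move=> f [].
- move=> f g [flim fx] [glim gx]; split; first exact: trig_limit_min.
  by move=> y K2y; rewrite lt_min fx ?gx.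
- have [f [flim fx fK2]] := step1 _ K1x.
  exists (fun y => -1 * f y); last by rewrite mulN1r ltrN2.
  split; first exact: trig_limitZ.
  by move=> y /fK2; rewrite mulN1r; lra.
exists (fun y => -1 * f y); split; first exact: trig_limitZ.
- by move=> x /fK1; rewrite mulN1r; lra.
- by move=> y /fK2; rewrite mulN1r; lra.
Qed.

Lemma trig_poly_urysohn K1 K2 e : compact K1 -> compact K2 -> K1 `&` K2 = set0 ->
  0 < e -> exists p : E -> R, [/\ trig_poly p, forall x, `|p x| <= 1,
    forall x, K1 x -> 1 - e <= p x & forall x, K2 x -> p x <= - 1 + e].
Proof.
move=> cK1 cK2 K12; wlog e1 : e / e <= 1 => [H e0|e0].
  have [e1|/ltW e1] := leP e 1; first exact: H.
  have [p [tp p1 pK1 pK2]] := H 1 (lexx _) ltr01.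
  by exists p; split=> // x => [/pK1|/pK2]; lra.
have [f [flim fK1 fK2]] := trig_limit_separates cK1 cK2 K12.
pose g x := (1 - e / 2) * Num.max (-1) (Num.min 1 (f x)).
have clim c : trig_limit (fun=> c) by exact/trig_poly_limit/trig_poly_cst.
have glim : trig_limit g.
  apply: trig_limitZ; apply: trig_limit_max; first exact: clim.
  by apply: trig_limit_min; first exact: clim.
have e20 : 0 < e / 2 by rewrite divr_gt0.
have [p tp gp] := glim _ e20.
have g1 x : `|g x| <= 1 - e / 2.
  rewrite /g normrM ger0_norm; last by lra.
  rewrite -[leRHS]mulr1 ler_wpM2l; [by []|lra|].
  rewrite ler_norml le_max lexx/= ge_max ge_min lexx/= andbT; lra.
exists p; split=> // x.
- have := g1 x; have := gp x; rewrite !ler_norml; lra.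
- move=> /fK1 fx; have := gp x; rewrite /g min_l ?(ltW fx)// max_r; last by lra.
  rewrite ler_norml; lra.
- move=> /fK2 fx; have := gp x; rewrite /g min_r ?max_l; [|lra|lra].
  rewrite ler_norml; lra.
Qed.

End stone_weierstrass.

(** * Means of the Ornstein-Uhlenbeck semigroup *)

Section caratheodory.
Context (R : realType) d (T : measurableType d).

Lemma measurable_right_continuous (G : R -> T -> R) :
    (forall r, 0 <= r -> measurable_fun setT (G r)) ->
    (forall r y, 0 <= r -> G (h + r) y @[h --> 0^'+] --> G r y) ->
  measurable_fun [set: measurableTypeR R * T] (fun p => G (Num.max 0 p.1) p.2).
Proof.
move=> mG cG.
pose node n k : R := k.+1%:R / n.+1%:R.
pose phi n (r : R) : R := node n (Num.truncn (n.+1%:R * r)).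
have node_ge0 n k : 0 <= node n k by rewrite divr_ge0.
have phi_gt n r : 0 < phi n r - Num.max 0 r <= n.+1%:R^-1.
  rewrite /phi /node; set k := Num.truncn _.
  have n0 : (0 : R) < n.+1%:R by [].
  have [r0|r0] := leP r 0.
    rewrite /k (_ : Num.truncn _ = 0%N).
      by rewrite subr0 mul1r invr_gt0 n0 lexx.
    apply/eqP; rewrite -leqn0 truncn_le_nat.
    by rewrite (le_lt_trans _ (ltr01 : 0 < 1%:R :> R))// pmulr_rle0.
  have /andP[kr rk] : k%:R <= n.+1%:R * r < k.+1%:R.
    by apply: truncn_itv; rewrite mulr_ge0// ltW.
  apply/andP; split; first by rewrite subr_gt0 ltr_pdivlMr// mulrC.
  by rewrite lerBlDr ler_pdivrMr// mulrDl mulVf ?gt_eqF// -natr1 addrC lerD2l mulrC.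
apply: (@measurable_fun_cvg _ _ _ _ (fun n p => G (phi n p.1) p.2)).
- move=> n _ A mA; rewrite setTI.
  rewrite (_ : _ @^-1` A = \bigcup_k
      ((fun r : measurableTypeR R => Num.truncn (n.+1%:R * r)) @^-1` [set k] `*`
       (G (node n k) @^-1` A))); last first.
    apply/seteqP; split=> [[r y] /= rA|[r y] /= [k _ [/= <-]]//].
    by exists (Num.truncn (n.+1%:R * r)).
  apply: bigcup_measurable => k _; apply: measurableX; last first.
    by rewrite -[X in measurable X]setTI; exact: mG.
  rewrite -[X in measurable X]setTI.
  have mtrunc j : measurable [set r : R | (Num.truncn (n.+1%:R * r) <= j)%N].
    rewrite (_ : [set _ | _] = `]-oo, (j.+1%:R / n.+1%:R)[%classic)//.
    by apply/seteqP; split=> r /=; rewrite in_itv/= truncn_le_nat ltr_pdivlMr// mulrC.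
  rewrite setTI; case: k => [|k].
    rewrite (_ : _ @^-1` _ = [set r | (Num.truncn (n.+1%:R * r) <= 0)%N])//.
    by apply/seteqP; split=> r /=; rewrite leqn0 => /eqP.
  rewrite (_ : _ @^-1` _ = [set r | (Num.truncn (n.+1%:R * r) <= k.+1)%N] `\`
      [set r | (Num.truncn (n.+1%:R * r) <= k)%N]); first exact: measurableD.
  apply/seteqP; split=> r /=; first by move=> ->; split; [exact: leqnn|rewrite ltnn].
  by move=> [rk /negP]; rewrite -ltnNge => kr; apply/eqP; rewrite eqn_leq rk.
- move=> [r y] _ /=; set a := Num.max 0 r.
  have a0 : 0 <= a by rewrite le_max lexx.
  apply/cvgrPdist_lt => e e0.
  have := cG a y a0 => /cvgrPdist_lt/(_ _ e0)[c /= c0 cH].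
  near=> n.
  have /andP[pn np] := phi_gt n r; rewrite -/a in pn np.
  have := cH (phi n r - a); rewrite subrK; apply => //.
  rewrite /= sub0r normrN gtr0_norm// (le_lt_trans np)//.
  near: n; exact: near_infty_natSinv_lt (PosNum c0).
Unshelve. all: by end_near. Qed.

End caratheodory.

Section means.
Context {R : realType}.
Notation leb := (@lebesgue_measure R).
Implicit Types (e c M : R) (u v : R -> R).

Definition mean e u : R := e^-1 * \int[leb]_(r in `[0, e]) u r.

Let lebesgue_itv0 e : 0 <= e -> fine (leb `[0, e]) = e.
Proof.
move=> e0; rewrite lebesgue_measure_itv/= lte_fin.
by case: ltgtP e0 => // <- _; rewrite ?oppr0 ?adde0.
Qed.

Lemma integrable_itv a b u M : measurable_fun setT u ->
  (forall r, a <= r <= b -> `|u r| <= M) -> leb.-integrable `[a, b] (EFin \o u).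
Proof.
move=> mu uM; apply: (@integrable_bounded _ (measurableTypeR R) _ leb _ _ M) => //.
- exact: lebesgue_measure_itvcc_lty.
- exact: measurable_funTS.
Qed.

Lemma Rintegral_itv_le e u M : 0 <= e -> measurable_fun setT u ->
  (forall r, 0 <= r <= e -> `|u r| <= M) -> `|\int[leb]_(r in `[0, e]) u r| <= M * e.
Proof.
move=> e0 mu uM.
have := @le_normr_Rintegral_bounded _ (measurableTypeR R) _ leb `[0, e] u M.
rewrite lebesgue_itv0//; apply => //.
- exact: lebesgue_measure_itvcc_lty.
- exact: measurable_funTS.
Qed.

Lemma mean_near e u c d : 0 < e -> measurable_fun setT u ->
  (forall r, 0 <= r <= e -> `|u r - c| <= d) -> `|mean e u - c| <= d.
Proof.
move=> e0 mu ucd.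
have -> : mean e u - c = e^-1 * \int[leb]_(r in `[0, e]) (u r - c).
  rewrite RintegralB//.
  - rewrite Rintegral_cst// lebesgue_itv0 ?ltW// mulrBr /mean; congr (_ - _).
    by rewrite mulrCA mulVf ?mulr1// gt_eqF.
  - apply: (@integrable_itv _ _ _ (d + `|c|)) => // r /ucd ur.
    by rewrite -(subrK c (u r)) (le_trans (ler_normD _ _))// lerD2r.
  - by apply: (@integrable_itv _ _ _ `|c|).
rewrite normrM gtr0_norm ?invr_gt0// ler_pdivrMl// mulrC.
apply: Rintegral_itv_le => //; first exact: ltW.
exact: measurable_funB.
Qed.

Lemma mean_le e u M : 0 < e -> measurable_fun setT u ->
  (forall r, 0 <= r <= e -> `|u r| <= M) -> `|mean e u| <= M.
Proof.
move=> e0 mu uM; rewrite -[mean e u]subr0; apply: mean_near => // r re.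
by rewrite subr0 uM.
Qed.

Lemma meanB e u v M : measurable_fun setT u -> measurable_fun setT v ->
    (forall r, 0 <= r <= e -> `|u r| <= M) ->
    (forall r, 0 <= r <= e -> `|v r| <= M) ->
  mean e u - mean e v = mean e (fun r => u r - v r).
Proof.
move=> mu mv uM vM.
by rewrite /mean RintegralB ?mulrBr//; [exact: integrable_itv mu uM|exact: integrable_itv mv vM].
Qed.

Lemma mean_shift_le e u h M : 0 < e -> 0 <= h -> measurable_fun setT u ->
    (forall r, `|u r| <= M) ->
  `|mean e (fun r => u (r + h)) - mean e u| <= 2 * M * h / e.
Proof.
move=> e0 h0 mu uM.
have iu a b : leb.-integrable `[a, b] (EFin \o u) by exact: (@integrable_itv _ _ _ M).
rewrite /mean -mulrBr normrM gtr0_norm ?invr_gt0// mulrC ler_wpM2r ?invr_ge0 ?(ltW e0)//.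
rewrite (@Rintegral_itv_shift _ u h 0 e M)// add0r.
have split_at a b c : a <= c <= b -> \int[leb]_(r in `[a, b]) u r =
    \int[leb]_(r in `[a, c]) u r + \int[leb]_(r in `[c, b]) u r.
  move=> /andP[ac cb]; rewrite -(@Rintegral_itv_obnd_cbnd _ c).
    by rewrite -(@Rintegral_itvB _ u (BLeft a) (BRight b) c) ?bnd_simp// [RHS]addrC subrK.
  apply: integrableS (iu a b) => // r /=; rewrite !in_itv/= => /andP[cr ->].
  by rewrite andbT (le_trans ac)// ltW.
have E : \int[leb]_(r in `[0, h]) u r + \int[leb]_(r in `[h, (e + h)]) u r =
    \int[leb]_(r in `[0, e]) u r + \int[leb]_(r in `[e, (e + h)]) u r.
  by rewrite -!split_at// ?h0 ?(ltW e0) ?lerDl ?lerDr ?(ltW e0).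
have := @Rintegral_itv_shift _ u e 0 h M mu (fun r _ => uM _).
rewrite add0r (addrC h) => shift_e.
have u1 := @Rintegral_itv_le h u M h0 mu (fun r _ => uM _).
have mue : measurable_fun setT (fun r : R => u (r + e)).
  by apply: measurableT_comp => //; exact: measurable_funD.
have u2 := @Rintegral_itv_le h _ M h0 mue (fun r _ => uM _).
move: u1 u2; rewrite shift_e !ler_norml.
move: E; lra.
Qed.

End means.

Section supremum_norm.
Context (R : realType) (E : completeNormedModType R).
Implicit Types (g : E -> R) (c : R).

Lemma le_supnorm g c x : (forall y, `|g y| <= c) -> `|g x| <= supnorm g.
Proof.
move=> gc; apply: ub_le_sup; last by exists x.
by exists c => _ [y _ <-].
Qed.

Lemma supnorm_ge0 g : 0 <= supnorm g.
Proof.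
have [[_ [c gc]]|nsup] := pselect (has_sup [set `|g x| | x in [set: E]]); last first.
  by rewrite /supnorm sup_out.
by apply: le_trans (@le_supnorm g c 0 _) => // y; apply: gc; exists y.
Qed.

Lemma supnorm_le g c : (forall x, `|g x| <= c) -> supnorm g <= c.
Proof.
move=> gc; apply: ge_sup; first by exists `|g 0|, 0.
by move=> _ [x _ <-].
Qed.

End supremum_norm.

Section ornstein_uhlenbeck_mean.
Context (R : realType) (E H : completeNormedModType R) (ip : {dot H for idfun}).
Hypothesis ip_norm : forall h : H, ip h h = `|h| ^+ 2.
Variable S : R -> {linear E -> E}.
Hypothesis S_C0 : C0_semigroup S.
Variable B : {linear H -> E}.
Hypothesis B_cont : continuous B.
Variable mu : R -> probability (borel E) R.
Hypothesis mu_gauss :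
  forall r : R, 0 <= r -> gaussian_radon (mu r) (cov_pairing ip S B r).
Notation leb := (@lebesgue_measure R).
Notation P := (OU S mu).

Variables (f : E -> R) (M : R).
Hypotheses (tf : trig_poly f) (fM : forall x, `|f x| <= M).
Implicit Types (r h e t : R) (x y : E).

Let path (x : E) r : R := P (Num.max 0 r) f x.

Let f_cont : continuous (f : E -> R^o). Proof. exact: trig_poly_continuous tf. Qed.

Let path_le x r : `|path x r| <= M.
Proof. exact: OU_le. Qed.

Let max0_ge0 r : 0 <= Num.max 0 r.
Proof. by rewrite le_max lexx. Qed.

Let OU_path_continuous r : 0 <= r -> continuous (P r f : E -> R^o).
Proof.
by move=> r0; apply: trig_poly_continuous; exact: (OU_trig_poly ip_norm S_C0 B_cont mu_gauss).
Qed.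

Let measurable_path_joint x :
  measurable_fun [set: measurableTypeR R * borel E] (fun p => path (x + p.2) p.1).
Proof.
apply: (@measurable_right_continuous R _ (borel E) (fun r (y : E) => P r f (x + y))) => r.
  move=> r0; apply: continuous_measurable_borel; apply: continuous_shift.
  exact: OU_path_continuous.
by move=> y r0; exact: (OU_right_continuous ip_norm S_C0 B_cont mu_gauss).
Qed.

Let measurable_path x : measurable_fun setT (path x).
Proof.
have := @measurable_fun_pair1 _ _ _ (measurableTypeR R) (borel E) R
  (fun p => path (x + p.2) p.1) (0 : E) (measurable_path_joint x).
by rewrite /= addr0.
Qed.

Definition OU_mean e x : R := mean e (path x).

Lemma OU_mean_le e x : 0 < e -> `|OU_mean e x| <= M.
Proof. by move=> e0; apply: mean_le. Qed.

Lemma OU_mean_lipschitz e : 0 < e ->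
  exists2 L, 0 <= L & forall x y, `|OU_mean e x - OU_mean e y| <= L * `|x - y|.
Proof.
move=> e0; have [L L0 fL] := trig_poly_lipschitz tf.
have [N N1 SN] := C0_semigroup_bounded S_C0 e.
have N0 : 0 <= N by rewrite (le_trans ler01).
exists (L * N) => [|x y]; first exact: mulr_ge0.
rewrite /OU_mean (@meanB _ _ _ _ M)//.
apply: mean_le => //; first exact: measurable_funB.
move=> r re; have /andP[r0 _] := re; rewrite /path max_r// /OU.
have [LI RI] : (mu r).-integrable setT (EFin \o (fun z : borel E => f (S r x + (z : E)))) /\
    (mu r).-integrable setT (EFin \o (fun z : borel E => f (S r y + (z : E)))).
  by split; exact: integrable_continuous_bounded fM.
rewrite -RintegralB//.
apply: (@le_trans _ _ (L * N * `|x - y| * fine (mu r setT))).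
  apply: le_normr_Rintegral_bounded => //; first exact: fin_num_fun_lty.
    by apply: measurable_funB; apply: continuous_measurable_borel; exact: continuous_shift.
  move=> z _; rewrite (le_trans (fL _ _))// -mulrA ler_wpM2l//.
  by rewrite opprD addrACA subrr addr0 -linearB SN.
by rewrite (congr1 fine (probability_setT (mu r))) mulr1.
Qed.

(* E need not be separable: the joint measurability that Fubini requires comes
   from the right continuity in time. *)
Lemma OU_OU_mean h e x : 0 <= h -> 0 < e ->
  P h (OU_mean e) x = mean e (fun r => path x (r + h)).
Proof.
move=> h0 e0.
have M0 : 0 <= M by rewrite (le_trans _ (fM 0)).
pose G (p : measurableTypeR R * borel E) : \bar R :=
  (path (S h x + (p.2 : E)) p.1 * \1_`[0, e] p.1)%:E.
have mG : measurable_fun setT G.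
  apply/measurable_EFinP; apply: measurable_funM; first exact: measurable_path_joint.
  by apply: measurableT_comp.
have G_le p : (`|G p| <= (M * \1_`[0, e] p.1)%:E)%E.
  rewrite lee_fin normrM (@ger0_norm _ (\1_ _ _)) ?indicE ?ler0n//.
  by rewrite ler_wpM2r// path_le.
have intM : leb.-integrable setT (EFin \o (fun r => M * \1_`[0, e] r)).
  rewrite (_ : EFin \o _ = fun r => (M%:E * (\1_`[0, e] r)%:E)%E)//.
  by apply: integrableZl => //; exact: (integrable_indic_itv 0 e true false).
have intG : (leb \x mu h)%E.-integrable setT G.
  apply/integrable12ltyP => //.
  apply: (@le_lt_trans _ _ (\int[leb]_r (M * \1_`[0, e] r)%:E)%E); last first.
    by have := integrable_lty measurableT intM.
  apply: ge0_le_integral => //.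
  - by move=> r _; apply: integral_ge0.
  - apply: (@measurable_fun_fubini_tonelli_F _ _ (measurableTypeR R) (borel E) R
      (mu h) (fun p => `|G p|)%E) => //.
    exact: measurableT_comp.
  - exact: measurable_int intM.
  - move=> r _; apply: (@le_trans _ _ (\int[mu h]_(y in setT) (M * \1_`[0, e] r)%:E)%E).
      apply: ge0_le_integral => //.
      by apply: measurableT_comp => //; exact: (@measurable_fun_pair2 _ _ _ _ _ _ G r mG).
    by rewrite integral_cst// [X in (_ * X)%E](probability_setT (mu h)) mule1.
have innery r : (\int[mu h]_y G (r, y) = (path x (r + h) * \1_`[0, e] r)%:E)%E.
  rewrite /G /= indicE; case: (boolP (r \in _)) => [|_]; last first.
    by under eq_integral do rewrite mulr0; rewrite integral0 mulr0.
  rewrite inE /= in_itv/= => /andP[r0 re].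
  under eq_integral do rewrite mulr1.
  rewrite mulr1 EFin_Rintegral//; last first.
    apply: integrable_continuous_bounded (OU_path_continuous (max0_ge0 r)) _ => y.
    exact: path_le.
  rewrite /path !max_r ?addr_ge0// addrC.
  by rewrite -(OU_semigroup ip_norm S_C0 B_cont mu_gauss tf h0 r0).
have innerr y : (\int[leb]_r G (r, y) = (e * OU_mean e (S h x + (y : E)))%:E)%E.
  rewrite /OU_mean /mean mulVKf ?gt_eqF// Rintegral_mkcond patch_indic.
  rewrite -EFin_Rintegral//.
  apply: (@le_integrable _ (measurableTypeR R) _ leb _ _ _
    (EFin \o (fun r => M * \1_`[0, e] r))) => //.
    by apply/measurable_EFinP; apply: measurable_funM => //; exact: measurable_path.
  move=> r _; apply: le_trans (G_le (r, y)) _.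
  by rewrite lee_fin ler_norm.
have := Fubini intG.
under eq_integral do rewrite innery.
under [X in _ = X -> _]eq_integral do rewrite innerr.
move=> /(congr1 fine) GE.
have : e * P h (OU_mean e) x = \int[leb]_(r in `[0, e]) path x (r + h).
  rewrite /OU -RintegralZl//; last first.
    have [L L0 mL] := OU_mean_lipschitz e0.
    apply: (integrable_continuous_bounded _ _ (M := M)); first exact: lipschitz_continuous mL.
    by move=> y; exact: OU_mean_le.
  by rewrite [RHS]Rintegral_mkcond patch_indic; exact: esym.
by rewrite /mean => <-; rewrite mulKf// gt_eqF.
Qed.

Lemma OU_mean_BUC e : 0 < e -> BUC (OU_mean e).
Proof.
move=> e0; split.
  have [L L0 fL] := OU_mean_lipschitz e0.
  apply/unif_continuousP => d d0; have L1 : 0 < L + 1 by rewrite ltr_wpDl.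
  exists (d / (L + 1)); first by rewrite divr_gt0.
  move=> [x y] /=; rewrite -!ball_normE /ball_ /= => xy.
  rewrite (le_lt_trans (fL x y))// (@le_lt_trans _ _ ((L + 1) * `|x - y|))//.
    by rewrite ler_wpM2r// lerDl.
  by rewrite -ltr_pdivlMl// mulrC.
exists M; split; first exact: num_real.
by move=> N MN x _; exact: le_trans (OU_mean_le x e0) (ltW MN).
Qed.

Lemma OU_mean_BUCo e : 0 < e -> BUCo S mu (OU_mean e).
Proof.
move=> e0; split; first exact: OU_mean_BUC.
have bound h : 0 <= h -> supnorm (P h (OU_mean e) \- OU_mean e) <= 2 * M / e * h.
  move=> h0; apply: supnorm_le => x /=; rewrite OU_OU_mean// mulrAC.
  by apply: mean_shift_le.
apply: (@squeeze_cvgr _ _ _ _ (fun=> 0) (fun h => 2 * M / e * h)).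
- near=> h; rewrite supnorm_ge0/=; apply: bound.
  by near: h; exact: nbhs_right_ge.
- exact: cvg_cst.
- rewrite -[X in _ --> X](mulr0 (2 * M / e)); apply: cvgM; first exact: cvg_cst.
  by apply: cvg_at_right_filter; exact: cvg_id.
Unshelve. all: by end_near. Qed.

Lemma OU_mean_cvg t x : 0 <= t ->
  P t (OU_mean e) x @[e --> 0^'+] --> P t f x.
Proof.
move=> t0; apply/cvgrPdist_le => d d0.
have /cvgrPdist_lt/(_ _ d0)[c /= c0 cP] :=
  OU_right_continuous ip_norm S_C0 B_cont mu_gauss (x := x) tf t0.
near=> e.
have e0 : 0 < e by near: e; exact: nbhs_right_gt.
have ec : e < c by near: e; exact: nbhs_right_lt.
rewrite OU_OU_mean// distrC; apply: mean_near => //.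
  by apply: (measurableT_comp (measurable_path x)); exact: measurable_funD.
move=> r /andP[]; rewrite le_eqVlt => /predU1P[<- _|r0 re].
  by rewrite add0r /path max_r// subrr normr0 ltW.
rewrite /path max_r ?addr_ge0 ?(ltW r0)// distrC ltW//.
apply: cP => //=; rewrite sub0r normrN gtr0_norm//.
exact: le_lt_trans re ec.
Unshelve. all: by end_near. Qed.

End ornstein_uhlenbeck_mean.

(** * Total variation and the operator norm *)

Section singularity.
Context d (T : measurableType d) (R : realType).
Variables mu nu : probability T R.

Lemma mutually_singular_from_tests :
    (forall e, 0 < e -> exists2 A, measurable A &
      (mu (~` A) <= e%:E)%E /\ (nu A <= e%:E)%E) ->
  mutually_singular mu nu.
Proof.
move=> tests.
have /choice[A AP] (n : nat) : exists A, [/\ measurable A,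
    (mu (~` A) <= (1 / (2 ^ n.+1)%:R)%:E)%E & (nu A <= (1 / (2 ^ n.+1)%:R)%:E)%E].
  have [|A mA [muA nuA]] := tests (1 / (2 ^ n.+1)%:R).
    by rewrite divr_gt0// ltr0n expn_gt0.
  by exists A.
have null (m : probability T R) (F : (set T)^nat) : (forall n, measurable (F n)) ->
    (forall n, m (F n) <= (1 / (2 ^ n.+1)%:R)%:E)%E -> m (~` lim_sup_set F) = 1%E.
  move=> mF mF_le.
  have mL : measurable (lim_sup_set F).
    by apply: bigcap_measurable => // k _; exact: bigcup_measurable.
  rewrite probability_setC// lim_sup_set_cvg0 ?sube0//.
  apply: (@le_lt_trans _ _ (\sum_(n <oo) (1 / (2 ^ n.+1)%:R)%:E)%E).
    by apply: lee_nneseries => [n _ _|n _]; [exact: measure_ge0|exact: mF_le].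
  by apply: (le_lt_trans (epsilon_trick0 xpredT ler01)); rewrite ltry.
have mA n : measurable (A n) by have [] := AP n.
exists (~` lim_sup_set (fun n => ~` A n)), (~` lim_sup_set A); split.
- apply: measurableC; apply: bigcap_measurable => // k _.
  by apply: bigcup_measurable => n _; exact: measurableC.
- apply: measurableC; apply: bigcap_measurable => // k _.
  by apply: bigcup_measurable.
- rewrite -subset0 => x [Cx Dx]; apply: Cx => n _.
  apply: contrapT => nx; apply: Dx => m _; exists (maxn m n); first exact: leq_maxl.
  apply: contrapT => nA; apply: nx; exists (maxn m n) => //; exact: leq_maxr.
- by apply: null => n; [exact: measurableC|have [] := AP n].
- by apply: null => n; have [] := AP n.
Qed.

End singularity.

Section operator_norm.
Context (R : realType) (E : completeNormedModType R).
Variables (S : R -> {linear E -> E}) (mu : R -> probability (borel E) R).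
Implicit Types (f g : E -> R) (r t s e : R) (x : E) (K : set E).
Notation P := (OU S mu).

Lemma BUC_continuous f : BUC f -> continuous (f : E -> R^o).
Proof.
move=> [/unif_continuousP fU _] x; apply/cvgrPdist_lt => e e0.
have [d d0 fd] := fU _ e0.
near=> y; have := fd (x, y); rewrite -!ball_normE /ball_ /=; apply.
by near: y; exact: (@cvgr_dist_lt _ _ _ (nbhs x) _ id x cvg_id _ d0).
Unshelve. all: by end_near. Qed.

Lemma BUC_le_supnorm f x : BUC f -> `|f x| <= supnorm f.
Proof.
move=> [_ [M [_ fM]]]; apply: (@le_supnorm _ _ _ (M + 1)) => y.
by apply: fM => //; rewrite ltrDl.
Qed.

Let unit_ball_le f x : BUCo S mu f -> supnorm f <= 1 -> `|f x| <= 1.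
Proof. by move=> [fB _]; apply: le_trans; exact: BUC_le_supnorm. Qed.

Lemma OU_sub_le2 f t s x : BUCo S mu f -> supnorm f <= 1 -> `|P t f x - P s f x| <= 2.
Proof.
move=> fB f1; have fc := BUC_continuous fB.1.
rewrite (le_trans (ler_normB _ _))// (_ : 2 = 1 + 1)//.
by apply: lerD; apply: OU_le => // y; exact: unit_ball_le.
Qed.

Let norms t s := [set supnorm (P t f \- P s f) | f in [set f | BUCo S mu f /\ supnorm f <= 1]].

Let norms_sup t s : has_sup (norms t s).
Proof.
split; last first.
  by exists 2 => _ [f [fB f1] <-]; apply: supnorm_le => x; exact: OU_sub_le2.
have P0 r : P r (fun=> 0) = (fun=> 0) by apply/funext => x; rewrite /OU Rintegral_cst// mul0r.
exists (supnorm (P t (fun=> 0) \- P s (fun=> 0))), (fun=> 0); split.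
  split.
    split; last first.
      by exists 0; split => // M M0 x _; rewrite normr0 ltW.
    apply/unif_continuousP => e e0; exists 1 => // x _; exact: ballxx.
  have -> : (fun r => supnorm (P r (fun=> 0) \- (fun=> 0))) = (fun=> 0 : R).
    apply/funext => r; apply/eqP; rewrite eq_le supnorm_ge0 andbT.
    by apply: supnorm_le => x; rewrite /= P0 subr0 normr0.
  exact: cvg_cst.
by apply: supnorm_le => x; rewrite normr0.
Qed.

Lemma opnorm_eq2P t s :
  opnorm (BUCo S mu) (fun f => P t f \- P s f) = 2 <->
  forall e, 0 < e -> exists f x,
    [/\ BUCo S mu f, forall y, `|f y| <= 1 & 2 - e < `|P t f x - P s f x|].
Proof.
split=> [norm2 e e0|large].
  have [_ [f [fB f1] <-]] := sup_adherent e0 (norms_sup t s).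
  rewrite -[sup _]/(opnorm _ _) norm2 => lt_norm.
  have f1' x := @unit_ball_le f x fB f1.
  apply: contrapT => nex; move: lt_norm; apply/negP; rewrite -leNgt.
  apply: supnorm_le => x; rewrite leNgt; apply/negP => fx.
  by apply: nex; exists f, x.
apply/eqP; rewrite eq_le; apply/andP; split.
  apply: ge_sup; first exact: (norms_sup t s).1.
  by move=> _ [f [fB f1] <-]; apply: supnorm_le => x; exact: OU_sub_le2.
apply/ler_addgt0Pr => e e0; have [f [x [fB f1 fx]]] := large _ e0.
rewrite -lerBlDr (le_trans (ltW fx))//.
have f1' : supnorm f <= 1 by exact: supnorm_le.
apply: (@le_trans _ _ (supnorm (P t f \- P s f))).
  by apply: (@le_supnorm _ _ (P t f \- P s f) 2 x) => y; exact: OU_sub_le2.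
by apply: ub_le_sup; [exact: (norms_sup t s).2|exists f].
Qed.

End operator_norm.

Section total_variation.
Context (R : realType) (E : completeNormedModType R).
Variables (S : R -> {linear E -> E}) (mu : R -> probability (borel E) R).
Implicit Types (f g : E -> R) (r t s e : R) (x y : E) (K : set E).
Notation P := (OU S mu).

Lemma measurable_open (U : set E) : open U -> measurable (U : set (borel E)).
Proof. by move=> oU; exact: sub_sigma_algebra. Qed.

Lemma measurable_compact K : compact K -> measurable (K : set (borel E)).
Proof.
move=> cK; rewrite -[K]setCK; apply: measurableC; apply: measurable_open.
by apply: closed_openC; apply: compact_closed => //; exact: norm_hausdorff.
Qed.

Let prob1 r : fine (mu r setT) = 1.
Proof. by rewrite (congr1 fine (probability_setT (mu r))). Qed.

Lemma integrable_indic_borel r (A : set (borel E)) : measurable A ->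
  (mu r).-integrable setT (EFin \o (\1_A : borel E -> R)).
Proof.
move=> mA; apply: (@integrable_bounded _ _ _ _ _ _ 1) => //.
  exact: fin_num_fun_lty.
by move=> y _; rewrite indicE; case: (_ \in _); rewrite ?normr1 ?normr0.
Qed.

Lemma Rintegral_indic_borel r (A : set (borel E)) : measurable A ->
  \int[mu r]_y (\1_A y) = fine (mu r A) :> R.
Proof. by move=> mA; rewrite /Rintegral integral_indic// setIT. Qed.

Lemma OU_opp f r x : continuous (f : E -> R^o) -> (forall y, `|f y| <= 1) ->
  P r (fun y => - f y) x = - P r f x.
Proof.
move=> cf f1; rewrite /OU -mulN1r -RintegralZl//.
  by apply: eq_Rintegral => y _; rewrite mulN1r.
exact: integrable_continuous_bounded f1.
Qed.

Lemma OU_le_measure f r x : continuous (f : E -> R^o) -> (forall y, `|f y| <= 1) ->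
  ((mu r) (~` [set y | (0 < f (S r x + y))%R] : set (borel E)) <= (1 - P r f x)%:E)%E.
Proof.
move=> cf f1; set A := ~` _.
have mA : measurable (A : set (borel E)).
  apply: measurableC; apply: measurable_open.
  apply: (@open_comp _ _ (fun y => f (S r x + y)) [set u | 0 < u]); last exact: open_gt.
  by move=> y _; exact: (continuous_shift cf).
rewrite -[(mu r A)]fineK ?fin_num_measure// lee_fin -Rintegral_indic_borel//.
have -> : 1 - P r f x = \int[mu r]_y (1 - f (S r x + (y : E))).
  rewrite RintegralB//; first by rewrite Rintegral_cst// [X in 1 * X]prob1 mulr1.
  - apply: (@integrable_bounded _ _ _ _ _ _ 1) => //; first exact: fin_num_fun_lty.
    by move=> y _; rewrite normr1.
  - exact: integrable_continuous_bounded f1.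
apply: le_Rintegral => //.
- exact: integrable_indic_borel.
- apply: (@integrable_continuous_bounded _ _ _ (fun y => 1 - f y) 2).
    by move=> y; apply: (@cvgB _ R^o); [exact: cvg_cst|exact: cf].
  by move=> y; rewrite (le_trans (ler_normB _ _))// normr1 (_ : 2 = 1 + 1)// lerD2l.
move=> y _; rewrite indicE; case: (boolP (y \in A)) => [|_].
  by rewrite inE /A /= => /negP; rewrite -leNgt; lra.
by have := f1 (S r x + y); rewrite ler_norml /=; lra.
Qed.

Lemma OU_ge_compact f r x K e : continuous (f : E -> R^o) -> (forall y, `|f y| <= 1) ->
    compact K -> ((mu r) (~` K : set (borel E)) <= e%:E)%E ->
    (forall y, K y -> 1 - e <= f (S r x + y)) ->
  1 - 3 * e <= P r f x.
Proof.
move=> cf f1 cK Ke fK.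
have mK : measurable (~` K : set (borel E)) by apply: measurableC; exact: measurable_compact.
have e0 : 0 <= e by rewrite -lee_fin (le_trans _ Ke).
have iK := integrable_indic_borel r mK.
apply: (@le_trans _ _ (\int[mu r]_y ((1 - e) - 2 * \1_(~` K : set (borel E)) y))).
  rewrite RintegralB//; last 2 first.
  - by apply: (@integrable_bounded _ _ _ _ _ _ `|1 - e|) => //; exact: fin_num_fun_lty.
  - rewrite (_ : EFin \o _ = fun y => (2%:E * (\1_(~` K : set (borel E)) y)%:E)%E)//.
    exact: integrableZl.
  rewrite RintegralZl// Rintegral_indic_borel// Rintegral_cst// [X in _ * X - _]prob1.
  have : fine (mu r (~` K)) <= e by rewrite -lee_fin fineK// fin_num_measure.
  lra.
apply: le_Rintegral => //.
- rewrite (_ : EFin \o _ =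
    (fun y => (1 - e)%:E - 2%:E * (\1_(~` K : set (borel E)) y)%:E)%E)//.
  apply: integrableB => //; last exact: integrableZl.
  apply: (@integrable_bounded _ _ _ _ _ (fun=> 1 - e) `|1 - e|) => //.
  exact: fin_num_fun_lty.
- exact: integrable_continuous_bounded f1.
move=> y _; rewrite indicE; case: (boolP (y \in _)) => [_|].
  by have := f1 (S r x + y); rewrite ler_norml /=; lra.
rewrite notin_setE => /contrapT /fK /=; lra.
Qed.

End total_variation.

Section norm_discontinuity.
Context (R : realType) (E H : completeNormedModType R) (ip : {dot H for idfun}).
Hypothesis ip_norm : forall h : H, ip h h = `|h| ^+ 2.
Variable S : R -> {linear E -> E}.
Hypothesis S_C0 : C0_semigroup S.
Variable B : {linear H -> E}.
Hypothesis B_cont : continuous B.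
Variable mu : R -> probability (borel E) R.
Hypothesis mu_gauss :
  forall r : R, 0 <= r -> gaussian_radon (mu r) (cov_pairing ip S B r).
Variables (t s : R).
Hypotheses (t_ge0 : 0 <= t) (s_ge0 : 0 <= s).
Implicit Types (e : R) (x y : E) (K : set E).
Notation P := (OU S mu).

Definition separated_translates e x K1 K2 :=
  [/\ compact K1, compact K2,
      ((mu t) (~` K1 : set (borel E)) <= e%:E)%E,
      ((mu s) (~` K2 : set (borel E)) <= e%:E)%E &
      forall y z, K1 y -> K2 z -> S t x + y <> S s x + z].

Lemma separated_translates_BUCo e x K1 K2 : 0 < e -> separated_translates e x K1 K2 ->
  exists f, [/\ BUCo S mu f, forall y, `|f y| <= 1 & 2 - 8 * e < P t f x - P s f x].
Proof.
move=> e0 [cK1 cK2 tK1 sK2 sep].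
have shift_compact a K : compact K -> compact [set a + y | y in K].
  move=> cK; apply: continuous_compact => //; apply: continuous_subspaceT => y.
  exact: (@cvgD _ E _ (nbhs y) _ (cst a) id a y (cvg_cst a) cvg_id).
have disj : [set S t x + y | y in K1] `&` [set S s x + y | y in K2] = set0.
  by rewrite -subset0 => _ [[y K1y <-] [z K2z /esym]]; exact: sep.
have [p [tp p1 pK1 pK2]] :=
  trig_poly_urysohn (shift_compact _ _ cK1) (shift_compact _ _ cK2) disj e0.
have pc := trig_poly_continuous tp.
have Pt : 1 - 3 * e <= P t p x.
  by apply: OU_ge_compact pc p1 cK1 tK1 _ => y K1y; apply: pK1; exists y.
have Ps : 1 - 3 * e <= - P s p x.
  rewrite -OU_opp//; apply: OU_ge_compact cK2 sK2 _ => [y|y|y K2y].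
  - by apply: (@cvgN _ R^o); exact: pc.
  - by rewrite normrN.
  - have : p (S s x + y) <= - 1 + e by apply: pK2; exists y.
    by rewrite /=; lra.
have near_mean r : 0 <= r -> \forall d \near (0 : R)^'+,
    `|P r p x - P r (OU_mean S mu p d) x| < e.
  move=> r0; have /cvgrPdist_lt/(_ _ e0) :=
    OU_mean_cvg ip_norm S_C0 B_cont mu_gauss tp p1 (x := x) r0.
  exact.
have [d [d0 dt ds]] : exists d : R, [/\ 0 < d,
    `|P t p x - P t (OU_mean S mu p d) x| < e &
    `|P s p x - P s (OU_mean S mu p d) x| < e].
  near (0 : R)^'+ => d; exists d; split; near: d;
    [exact: nbhs_right_gt|exact: near_mean|exact: near_mean].
exists (OU_mean S mu p d); split.
- exact: (OU_mean_BUCo ip_norm S_C0 B_cont mu_gauss tp p1).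
- by move=> y; exact: (OU_mean_le ip_norm S_C0 B_cont mu_gauss tp p1).
- by move: dt ds; rewrite !ltr_norml; lra.
Unshelve. all: by end_near. Qed.

Let radon_compact r (A : set (borel E)) e : 0 <= r -> 0 < e -> measurable A ->
    (mu r) A = 1%E ->
  exists K, [/\ compact K, K `<=` A & ((mu r) (~` K : set (borel E)) <= e%:E)%E].
Proof.
move=> r0 e0 mA A1; have [/(_ _ mA _ e0)[K [cK KA AKe]] _] := mu_gauss r0.
exists K; split=> //; have mK := measurable_compact cK.
have mAK : measurable (A `\` K : set (borel E)) by exact: measurableD.
have mAC := measurableC mA.
apply: (@le_trans _ _ (mu r (~` A `|` (A `\` K)))).
  apply: le_measure; rewrite ?inE//; [exact: measurableC|exact: measurableU|].
  by move=> y /= Ky; have [Ay|] := pselect (A y); [right|left].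
apply: (le_trans (measureU2 _ _ _)) => //.
have AC0 : (mu r) (~` A) = 0%E by have := probability_setC (mu r) mA; rewrite A1 subee.
by rewrite [X in (X + _)%E]AC0 add0e ltW.
Qed.

Lemma ne_separated_translates e : 0 < e -> (S t : E -> E) <> S s ->
  exists x K1 K2, separated_translates e x K1 K2.
Proof.
move=> e0 Sts.
have [x0 Sx0] : exists x, S t x != S s x.
  apply: contrapT => nx; apply: Sts; apply/funext => x; apply/eqP.
  by apply: contrapT => /negP Sx; apply: nx; exists x.
have [K1 [cK1 _ tK1]] := radon_compact t_ge0 e0 measurableT (probability_setT (mu t)).
have [K2 [cK2 _ sK2]] := radon_compact s_ge0 e0 measurableT (probability_setT (mu s)).
have bound K : compact K -> exists M : R, forall y, K y -> `|y| <= M.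
  move=> /compact_bounded[M [_ KM]]; exists (M + 1) => y Ky.
  by apply: (KM _ _ y Ky); rewrite ltrDl.
have [M1 KM1] := bound _ cK1; have [M2 KM2] := bound _ cK2.
pose d := `|S t x0 - S s x0|.
have d0 : 0 < d by rewrite normr_gt0 subr_eq0.
pose n := (Num.truncn ((M1 + M2) / d)).+1.
exists (n%:R *: x0), K1, K2; split=> // y z K1y K2z yz.
have : (M1 + M2) / d < n%:R by rewrite truncnS_gt.
rewrite ltr_pdivrMr//; apply/negP; rewrite -leNgt.
have -> : n%:R * d = `|z - y|.
  rewrite /d -[n%:R]ger0_norm// -normrZ scalerBr -!linearZ; congr `|_|.
  apply/eqP; rewrite subr_eq addrAC -subr_eq opprK; apply/eqP.
  by rewrite yz addrC.
by rewrite (le_trans (ler_normB _ _))// addrC lerD ?KM1 ?KM2.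
Qed.

Lemma singular_separated_translates e : 0 < e -> mutually_singular (mu t) (mu s) ->
  exists x K1 K2, separated_translates e x K1 K2.
Proof.
move=> e0 [C [D [mC mD CD C1 D1]]].
have [K1 [cK1 KC tK1]] := radon_compact t_ge0 e0 mC C1.
have [K2 [cK2 KD sK2]] := radon_compact s_ge0 e0 mD D1.
exists 0, K1, K2; split=> // y z /KC Cy /KD Dz; rewrite !linear0 !add0r => yz.
have : (C `&` D) y by split=> //; rewrite yz.
by rewrite CD.
Qed.

Lemma singular_of_BUC : (S t : E -> E) = S s ->
    (forall e, 0 < e -> exists f x,
      [/\ BUCo S mu f, forall y, `|f y| <= 1 & 2 - e < `|P t f x - P s f x|]) ->
  mutually_singular (mu t) (mu s).
Proof.
move=> Sts large; apply: mutually_singular_from_tests => e e0.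
have [g [x [gc g1 gx]]] : exists g x, [/\ continuous (g : E -> R^o),
    forall y, `|g y| <= 1 & 2 - e < P t g x - P s g x].
  have [f [x [fB f1 fx]]] := large _ e0; have fc := BUC_continuous fB.1.
  have [P0|P0] := leP 0 (P t f x - P s f x); first by exists f, x; rewrite ger0_norm in fx.
  exists (fun y => - f y), x; split.
  - by move=> y; apply: (@cvgN _ R^o); exact: fc.
  - by move=> y; rewrite normrN.
  - by rewrite !OU_opp//; move: fx; rewrite ltr0_norm//; lra.
have Pt1 := @OU_le _ _ S mu g 1 t x gc g1.
have Ps1 := @OU_le _ _ S mu g 1 s x gc g1.
have gNc : continuous ((fun y => - g y) : E -> R^o).
  by move=> y; apply: (@cvgN _ R^o); exact: gc.
have gN1 y : `|- g y| <= 1 by rewrite normrN.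
have open_pos (f : E -> R) : continuous (f : E -> R^o) ->
    measurable ([set y | 0 < f (S t x + y)] : set (borel E)).
  move=> fc; apply: measurable_open.
  apply: (@open_comp _ _ (fun y => f (S t x + y)) [set u | 0 < u]); last exact: open_gt.
  by move=> y _; exact: (continuous_shift fc).
exists [set y | 0 < g (S t x + y)]; first exact: open_pos.
split.
  apply: (le_trans (@OU_le_measure _ _ S mu g t x gc g1)); rewrite lee_fin.
  by move: Ps1; rewrite ler_norml; lra.
apply: (@le_trans _ _ (mu s (~` [set y | 0 < - g (S s x + y)]))).
  rewrite -Sts; apply: le_measure; rewrite ?inE; [exact: open_pos| |].
    by apply: measurableC; exact: (open_pos (fun y => - g y)).
  by move=> y /=; lra.
apply: (le_trans (@OU_le_measure _ _ S mu _ s x gNc gN1)); rewrite lee_fin OU_opp//.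
by move: Pt1; rewrite ler_norml; lra.
Qed.

End norm_discontinuity.

Theorem theorem2p8 (R : realType) (E H : completeNormedModType R)
    (ip : {dot H for idfun}) (ip_norm : forall h : H, ip h h = `|h| ^+ 2)
    (S : R -> {linear E -> E}) (S_C0 : C0_semigroup S)
    (B : {linear H -> E}) (B_cont : continuous B)
    (mu : R -> probability (borel E) R)
    (mu_gauss : forall r : R, 0 <= r -> gaussian_radon (mu r) (cov_pairing ip S B r))
    (t s : R) (t_ge0 : 0 <= t) (s_ge0 : 0 <= s) :
  opnorm (BUCo S mu) (fun f => OU S mu t f \- OU S mu s f) = 2 <->
  (S t : E -> E) <> S s \/ mutually_singular (mu t) (mu s).
Proof.
rewrite opnorm_eq2P; split=> [large|sep e e0].
  have [Sts|] := pselect ((S t : E -> E) = S s); last by left.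
  by right; exact: singular_of_BUC Sts large.
have e8 : 0 < e / 8 by rewrite divr_gt0.
have [x [K1 [K2 /separated_translates_BUCo]]] :
    exists x K1 K2, separated_translates S mu t s (e / 8) x K1 K2.
  by case: sep; [exact: (ne_separated_translates mu_gauss)|
                 exact: (singular_separated_translates mu_gauss)].
move=> /(_ _ _ ip_norm S_C0 _ B_cont mu_gauss t_ge0 s_ge0 e8)[f [fB f1 fx]].
exists f, x; split=> //; apply: lt_le_trans (ler_norm _).
by move: fx; rewrite mulrC divfK.
Qed.
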